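(* For every countable group $\Gamma$ there exists a countable group $G$ such that $\Gamma$ embeds into $G$, $G$ has trivial amenable radical, and $G$ is not $C^\ast$-simple. If moreover $\Gamma$ is finitely generated, or torsion free, or both, then $G$ can be taken to be finitely generated, or torsion free, or both, respectively.
   Context: All groups are regarded as discrete groups. A countable group $G$ is $C^\ast$-simple if its reduced $C^\ast$-algebra (the operator norm closure of the group algebra $\mathbf{C}[G]$ acting on $\ell^2(G)$ by the left-regular representation) has no non-trivial two-sided closed ideal. The amenable radical of a group is its largest amenable normal subgroup. *)

(* Defs.v *)
From HB Require Import structures.
From mathcomp Require Import all_boot all_order all_algebra.
From mathcomp Require Import all_classical all_reals ereal esum.
From mathcomp Require Import complex ring.

Set Implicit Arguments.
Unset Strict Implicit.
Unset Printing Implicit Defensive.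

Import Order.TTheory GRing.Theory Num.Theory.
Local Open Scope classical_set_scope.
Local Open Scope ring_scope.
Local Open Scope complex_scope.

Section Groups.
Variable G : groupType.
Implicit Types H N : set G.

Definition is_subgroup H : Prop :=
  [/\ H 1%g, (forall x y, H x -> H y -> H (x * y)%g)
    & (forall x, H x -> H (x^-1)%g)].

Definition is_normal_subgroup N : Prop :=
  is_subgroup N /\ (forall g x, N x -> N (x ^ g)%g).

Definition finitely_generated : Prop :=
  exists2 S : set G, finite_set S & smallest is_subgroup S = [set: G].

Definition torsion_free : Prop :=
  forall (g : G) (n : nat), (0 < n)%N -> (g ^+ n)%g = 1%g -> g = 1%g.

End Groups.
Arguments finitely_generated : clear implicits.
Arguments torsion_free : clear implicits.

Definition embeds (H G : groupType) : Prop :=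
  exists f : {multiplicative H -> G}, injective f.

Section Amenability.
Variables (R : realType) (G : groupType).
Implicit Types H N : set G.

(* The discrete group H carries a left-invariant finitely additive probability
   measure defined on all of its subsets.  The values of mu on sets that are
   not contained in H play no role. *)
Definition amenable H : Prop :=
  exists mu : set G -> R,
    [/\ (forall A, A `<=` H -> 0 <= mu A),
        mu H = 1,
        (forall A B, A `<=` H -> B `<=` H -> A `&` B = set0 ->
           mu (A `|` B) = mu A + mu B)
      & (forall h A, H h -> A `<=` H ->
           mu [set (h * a)%g | a in A] = mu A)].

Definition is_amenable_radical N : Prop :=
  [/\ is_normal_subgroup N, amenable N
    & (forall M, is_normal_subgroup M -> amenable M -> M `<=` N)].

End Amenability.

Definition trivial_amenable_radical (R : realType) (G : groupType) : Prop :=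
  is_amenable_radical R [set 1%g : G].

Section Ell2.
Variables (R : realType) (G : groupType).

Definition sqnorm (x : G -> R[i]) : \bar R :=
  \esum_(g in [set: G]) (Normc.normc (x g) ^+ 2)%:E.

Definition square_summable : {pred G -> R[i]} :=
  [pred x | `[< (sqnorm x < +oo)%E >]].

Lemma square_summableP x :
  reflect (sqnorm x < +oo)%E (x \in square_summable).
Proof. exact: asboolP. Qed.

Lemma sqnorm_ge0 x : (0 <= sqnorm x)%E.
Proof. by apply: esum_ge0 => g _; rewrite lee_fin sqr_ge0. Qed.

Lemma square_summable_submod : submod_closed square_summable.
Proof.
split.
  apply/square_summableP; rewrite /sqnorm esum1 ?ltry// => g _.
  by rewrite Normc.normc0 expr0n.
move=> a x y /square_summableP xfin /square_summableP yfin.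
apply/square_summableP; set k := 2 * Normc.normc a ^+ 2.
have k0 : 0 <= k by rewrite mulr_ge0// sqr_ge0.
have summandZ (c : R) (z : G -> R[i]) : 0 <= c -> (sqnorm z < +oo)%E ->
    (\esum_(g in [set: G]) (c * Normc.normc (z g) ^+ 2)%:E < +oo)%E.
  move=> c0 zfin.
  have zf : sqnorm z \is a fin_num by rewrite ge0_fin_numE// sqnorm_ge0.
  apply: (@le_lt_trans _ _ (c * fine (sqnorm z))%:E); last exact: ltry.
  apply: ge_ereal_sup => _ [A [Afin _] <-].
  have le1 : (\sum_(g \in A) (Normc.normc (z g) ^+ 2)%:E <= sqnorm z)%E.
    by apply: ereal_sup_ubound; exists A.
  move: c0; rewrite -lee_fin EFinM fineK// => c0.
  apply: (le_trans _ (lee_wpmul2l c0 le1)).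
  rewrite ge0_mule_fsumr; last by move=> g; rewrite lee_fin sqr_ge0.
  by under eq_fsbigr do rewrite EFinM.
have xk := summandZ k x k0 xfin.
have y2 := summandZ 2 y (ler0n _ _) yfin.
apply: (@le_lt_trans _ _ (\esum_(g in [set: G])
   ((k * Normc.normc (x g) ^+ 2)%:E + (2 * Normc.normc (y g) ^+ 2)%:E))%E).
  apply: le_esum => g _; rewrite -EFinD lee_fin.
  have E : (a *: x + y) g = a * x g + y g by [].
  have nge0 (z : R[i]) : 0 <= Normc.normc z by case: z => u v; apply: sqrtr_ge0.
  have := le_normcD (a * x g) (y g); rewrite Normc.normcM -E => le1.
  apply: (@le_trans _ _
    ((Normc.normc a * Normc.normc (x g) + Normc.normc (y g)) ^+ 2)).
    by rewrite ler_pXn2r// nnegrE ?addr_ge0 ?mulr_ge0.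
  rewrite -subr_ge0 /k.
  rewrite (_ : _ - _ =
    (Normc.normc a * Normc.normc (x g) - Normc.normc (y g)) ^+ 2) ?sqr_ge0//.
  by ring.
rewrite esumD; first exact: lte_add_pinfty.
  by move=> g _; rewrite lee_fin mulr_ge0// sqr_ge0.
by move=> g _; rewrite lee_fin mulr_ge0// sqr_ge0.
Qed.

HB.instance Definition _ :=
  GRing.isSubmodClosed.Build R[i] (G -> R[i]) square_summable
    square_summable_submod.

Record ell2 := Ell2 { ell2_fun :> G -> R[i]; _ : ell2_fun \in square_summable }.

HB.instance Definition _ := [isSub for ell2_fun].
HB.instance Definition _ := [Choice of ell2 by <:].
HB.instance Definition _ := [SubChoice_isSubLmodule of ell2 by <:].

Definition ell2_norm (x : ell2) : R := Num.sqrt (fine (sqnorm x)).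

Lemma translate_square_summable (g : G) (x : ell2) :
  (fun h : G => x (g^-1 * h)%g) \in square_summable.
Proof.
case: x => x /= /square_summableP xfin; apply/square_summableP.
suff -> : sqnorm (fun h => x (g^-1 * h)%g) = sqnorm x by [].
rewrite /sqnorm [RHS](@reindex_esum _ G G setT setT (fun h => g^-1 * h)%g)//.
split=> //.
- by move=> u v _ _ /= /mulgI.
- by move=> h _; exists (g * h)%g => //; rewrite mulgA mulVg mul1g.
Qed.

Definition left_regular (g : G) (x : ell2) : ell2 :=
  Ell2 (translate_square_summable g x).

Definition opnorm (T : ell2 -> ell2) : \bar R :=
  ereal_sup [set (ell2_norm (T x))%:E | x in [set x | ell2_norm x <= 1]].

Definition bounded_operator : set (ell2 -> ell2) :=
  [set T | linear T /\ (opnorm T < +oo)%E].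

(* Norm closure inside the algebra of all bounded operators on ell2. *)
Definition opnorm_closure (X : set (ell2 -> ell2)) : set (ell2 -> ell2) :=
  [set T | bounded_operator T /\
    forall eps : R, 0 < eps ->
      exists2 S, X S & (opnorm (T - S)%R < eps%:E)%E].

(* The image of the group algebra under the left-regular representation. *)
Definition group_algebra : set (ell2 -> ell2) :=
  [set T | exists (s : seq G) (c : G -> R[i]),
    T = \sum_(g <- s) c g *: left_regular g].

Definition reduced_Cstar_algebra : set (ell2 -> ell2) :=
  opnorm_closure group_algebra.

(* The reduced algebra is norm closed, so an ideal is closed in it iff it is
   closed among all bounded operators. *)
Definition closed_two_sided_ideal (I : set (ell2 -> ell2)) : Prop :=
  [/\ I `<=` reduced_Cstar_algebra,
      I 0 /\ (forall (a : R[i]) S T, I S -> I T -> I (a *: S + T)),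
      (forall A T, reduced_Cstar_algebra A -> I T -> I (A \o T)),
      (forall A T, reduced_Cstar_algebra A -> I T -> I (T \o A))
    & opnorm_closure I `<=` I].

Definition Cstar_simple : Prop :=
  forall I, closed_two_sided_ideal I ->
    I = [set 0] \/ I = reduced_Cstar_algebra.

End Ell2.

(* Main.v *)
(* Let A = Gamma x Z^2 and let Z act on A by powers of the shear th of Z^2.  The
   free product A * A acts on itself by left multiplication; G is generated by
   it together with the twist c w |-> th(c) w, for c in the first factor and w
   not starting with a letter of that factor.  Elements of G act on the set of
   reduced words as on the edges of the Bass-Serre tree of A * A: at each vertex
   they are a left translation composed with a power of th, which is trivial at
   all but finitely many vertices.
   - The stabilizer H of the empty word preserves the length of words.  Its
     finite subsets lie in solvable subgroups, since two elements fixing all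
     words of length d commute on words of length d + 1; so H is amenable.
   - The twist and a conjugate of it by a letter of the second factor are
     nontrivial elements with disjoint supports on G/H; hence
     (1 - a)(1 - b) is a nonzero element of C[G] that is killed by the
     representation on l^2(G/H), and this representation is weakly contained in
     the regular one because H is amenable.
   - Every nontrivial element moves some cone of words off itself, while
     complements of one-letter cones can be moved into any cone; hence no
     nontrivial normal subgroup has an invariant mean.
   - A conjugate of minimal displacement of the empty word shows that a torsion
     element fixes a word or a vertex, and then torsion-freeness of A applies. *)
From HB Require Import structures.
Require Import Defs.
From mathcomp Require Import all_boot all_order all_algebra.
From mathcomp Require Import all_classical all_reals ereal esum.
From mathcomp Require Import complex ring lra zify.

Set Implicit Arguments.
Unset Strict Implicit.
Unset Printing Implicit Defensive.

Import Order.TTheory GRing.Theory Num.Theory.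
Local Open Scope classical_set_scope.
Local Open Scope group_scope.

(** * Bijections and generated subgroups *)

Section Bijections.
Variable T : Type.

Record bij := Bij {
  bij_fun :> T -> T;
  bij_inv : T -> T;
  bij_funK : cancel bij_fun bij_inv;
  bij_invK : cancel bij_inv bij_fun }.

Lemma bijP (p q : bij) : p =1 q -> p = q.
Proof.
case: p => f f' fK f'K; case: q => g g' gK g'K /= /funext efg; subst g.
have e : f' = g' by apply/funext => x; rewrite -{1}(g'K x) fK.
by subst g'; congr Bij; exact: Prop_irrelevance.
Qed.

HB.instance Definition _ := gen_eqMixin bij.
HB.instance Definition _ := gen_choiceMixin bij.

Definition bij1 := @Bij id id (frefl _) (frefl _).

Definition bijM (p q : bij) : bij :=
  Bij (can_comp (@bij_funK p) (@bij_funK q))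
      (can_comp (@bij_invK q) (@bij_invK p)).

Definition bijV (p : bij) : bij := Bij (@bij_invK p) (@bij_funK p).

Fact bijMA : associative bijM. Proof. by move=> p q r; apply: bijP. Qed.
Fact bij1M : left_id bij1 bijM. Proof. by move=> p; apply: bijP. Qed.
Fact bijM1 : right_id bij1 bijM. Proof. by move=> p; apply: bijP. Qed.
Fact bijVM : left_inverse bij1 bijV bijM.
Proof. by move=> p; apply: bijP => x /=; rewrite bij_funK. Qed.
Fact bijMV : right_inverse bij1 bijV bijM.
Proof. by move=> p; apply: bijP => x /=; rewrite bij_invK. Qed.

HB.instance Definition _ := isGroup.Build bij bijMA bij1M bijM1 bijVM bijMV.

End Bijections.

(** * Generated subgroups as groups in their own right *)

Section GeneratedSubgroup.
Variables (P : groupType) (S : set P).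

Definition generated : {pred P} := [pred x | `[< smallest (@is_subgroup P) S x >]].

Lemma is_subgroup_generated : is_subgroup (smallest (@is_subgroup P) S).
Proof.
split=> [H [[]//]|x y Hx Hy H HS|x Hx H HS]; have [[_ HM HV] _] := HS.
  exact: (HM _ _ (Hx H HS) (Hy H HS)).
exact: (HV _ (Hx H HS)).
Qed.

Fact generated_group_closed : group_closed generated.
Proof.
have [g1 gM gV] := is_subgroup_generated.
split=> [|x y /asboolP gx /asboolP gy]; apply/asboolP; first exact: g1.
by apply: gM => //; apply: gV.
Qed.

Record subgrp := Subgrp { sval_ :> P; _ : sval_ \in generated }.
HB.instance Definition _ := [isSub for sval_].
HB.instance Definition _ := [Choice of subgrp by <:].
HB.instance Definition _ :=
  SubChoice_isSubGroup.Build P generated subgrp generated_group_closed.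

(** Minimality of the generated subgroup lives in the ambient group [P]; it is carried over to the
    subtype by applying it to the image of [K] in [P]. *)
Lemma subgrp_ind (K : set subgrp) : is_subgroup K ->
  (forall x (Sx : x \in generated), S x -> K (Subgrp Sx)) -> K = setT.
Proof.
move=> [K1 KM KV] KS; apply/seteqP; split=> // -[x gx] _.
suff [gx' Kx] : exists Sx, K (@Subgrp x Sx).
  by rewrite (_ : Subgrp gx = Subgrp gx') //; apply: val_inj.
refine (@smallest_sub _ (@is_subgroup P) S [set y | exists Sy, K (@Subgrp y Sy)]
    _ _ x (asboolW gx)) => [|y Sy /=]; last first.
  have gy : y \in generated by apply/asboolP; exact: sub_gen_smallest.
  by exists gy; apply: KS.
have toK u : K u -> exists Sx, K (@Subgrp (val u) Sx).
  by case: u => u gu Ku; exists gu.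
split=> /=.
- exact: toK K1.
- move=> u v [gu Ku] [gv Kv].
  exact: (toK _ (KM _ _ Ku Kv)).
- move=> u [gu Ku]; exact: (toK _ (KV _ Ku)).
Qed.

End GeneratedSubgroup.
(** Every element is the value of a finite word in signed indices of generators, and there are
    countably many such words. *)
Lemma countable_subgrp (P : groupType) (S : set P) :
  countable S -> countable [set: subgrp S].
Proof.
move=> /countable_injP[f finj].
pose e n : P := xget 1 [set x | S x /\ f x = n].
have eP x : S x -> e (f x) = x.
  move=> Sx; rewrite /e; case: xgetP => [y _ [Sy fyx]|/(_ x)[]//].
  by apply: finj; rewrite ?inE.
pose prd (s : seq (bool * nat)) : P :=
  foldr (fun u x => (if u.1 then e u.2 else (e u.2)^-1) * x) 1 s.
have prd_cat s t : prd (s ++ t) = prd s * prd t.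
  by elim: s => [|u s /= ->] /=; rewrite ?mul1g// mulgA.
have prdV s : prd (rev [seq (~~ u.1, u.2) | u <- s]) = (prd s)^-1.
  elim: s => [|[b x] s IH] /=; first by rewrite invg1.
  rewrite rev_cons -cats1 prd_cat IH /= mulg1 invgM.
  by case: b => /=; rewrite ?invgK.
pose g s : subgrp S := insubd 1 (prd s).
apply: (@sub_countable _ _ _ [set: seq (bool * nat)]); last exact: countableP.
suff -> : [set: subgrp S] = g @` setT by exact: card_image_le.
apply/seteqP; split=> // -[x gx] _.
suff [s es] : exists s, prd s = x.
  by exists s => //; apply: val_inj; rewrite /g val_insubd es gx.
refine (@smallest_sub _ (@is_subgroup P) S [set y | exists s, prd s = y]
  _ _ x (asboolW gx)) => [|y Sy /=]; last first.
  by exists [:: (true, f y)]; rewrite /= mulg1 eP.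
split=> [|_ _ [s <-] [t <-]|_ [s <-]]; first by exists [::].
- by exists (s ++ t).
- by exists (rev [seq (~~ u.1, u.2) | u <- s]).
Qed.

(** * Reduced words in the free product A * A *)

Section Words.
Variable A : groupType.
Implicit Types (i j : bool) (c d : A).

Definition ends i (w : seq (bool * A)) : bool :=
  if w is (j, _) :: _ then j == i else false.

(* Words are stored from right to left: the head of the list is the last
   letter, so that right multiplication acts on the head. *)
Fixpoint reduced (w : seq (bool * A)) : bool :=
  if w is (i, c) :: w' then [&& c != 1, ~~ ends i w' & reduced w'] else true.

(** Only multiplication by single letters is defined. It yields a free right action of each factor
    on the reduced words; the free product itself enters through its left translations. *)
Definition rmul i c (w : seq (bool * A)) : seq (bool * A) :=
  if ends i w then
    if (head (i, 1) w).2 * c == 1 then behead w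
    else (i, (head (i, 1) w).2 * c) :: behead w
  else if c == 1 then w else (i, c) :: w.

Lemma reduced_rmul i c w : reduced w -> reduced (rmul i c w).
Proof.
case: w => [|[j d] w]; rewrite /rmul /=; first by case: eqP => //= /eqP ->.
move=> /and3P[d1 ew rw]; case: eqVneq => [<-|ji]; case: ifPn => //= c1.
- by rewrite c1 ew.
- by rewrite d1 ew.
- by rewrite c1 ji d1 ew.
Qed.

Record word := Word { wseq :> seq (bool * A); _ : reduced wseq }.
HB.instance Definition _ := [isSub for wseq].
HB.instance Definition _ := [Choice of word by <:].

Definition word0 : word := @Word [::] isT.
Definition rm i c (w : word) : word := Word (reduced_rmul i c (valP w)).

Lemma rm_cons i c (w : word) : ~~ ends i w -> c != 1 ->
  rm i c w = (i, c) :: w :> seq _.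
Proof. by rewrite /= /rmul => /negPf -> /negPf ->. Qed.

Lemma rm1 i w : rm i 1 w = w.
Proof.
apply: val_inj; rewrite /= /rmul; case: w => -[|[j d] w] /=; rewrite eqxx //.
by move=> /and3P[/negPf d1 _ _]; case: eqP => // <-; rewrite mulg1 d1.
Qed.

Lemma rmM i c d w : rm i c (rm i d w) = rm i (d * c) w.
Proof.
apply: val_inj; rewrite /= /rmul; case: w => -[|[j e] w] /=.
  case: (eqVneq d 1) => [->|d1] _ /=; first by rewrite mul1g.
  by rewrite eqxx.
case: (eqVneq j i) => [->|ji] /and3P[e1 ew rw] /=.
  rewrite mulgA; case: (eqVneq (e * d) 1) => [ed|ed] /=; last by rewrite eqxx.
  by rewrite (negPf ew) ed mul1g.
case: (eqVneq d 1) => [->|d1] /=; first by rewrite (negPf ji) mul1g.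
by rewrite eqxx.
Qed.

Lemma rmK i c : cancel (rm i c) (rm i c^-1).
Proof. by move=> w; rewrite rmM mulgV rm1. Qed.

Lemma word_ind (P : word -> Prop) : P word0 ->
  (forall i c (w : word), c != 1 -> ~~ ends i w -> P w -> P (rm i c w)) -> forall w, P w.
Proof.
move=> P0 PS [w rw]; elim: w rw => [|[i c] w IH] rw.
  by rewrite (_ : Word rw = word0) //; apply: val_inj.
have /and3P[c1 ew rw'] := rw.
suff -> : Word rw = rm i c (Word rw') by apply: PS.
by apply: val_inj; exact: esym (@rm_cons i c (Word rw') ew c1).
Qed.

Lemma wordP (w : word) :
  w = word0 \/ exists i c (w' : word), [/\ c != 1, ~~ ends i w' & w = rm i c w'].
Proof.
by elim/word_ind: w => [|i c w c1 ew _]; [left|right; exists i, c, w].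
Qed.

Lemma ends_rm i c (w : word) : ~~ ends i w -> c != 1 -> ends i (rm i c w).
Proof. by move=> ew c1; rewrite rm_cons //= eqxx. Qed.

Lemma ends_uniq i j (w : word) : ends i w -> ends j w -> i = j.
Proof. by case: w => -[|[k c] w] //= _ /eqP <- /eqP <-. Qed.

Lemma rm_free i c (w : word) : rm i c w = w -> c = 1.
Proof.
move=> /(congr1 val); rewrite /= /rmul; case: w => -[|[j e] w] /=.
  by case: eqP.
move=> _; case: eqP => [_|_]; case: eqP => // _ /(congr1 (fun s => (size s, head (i, 1) s))) /=.
- by move=> [] /n_Sn.
- by case=> _ /(congr1 (fun x => e^-1 * x)); rewrite mulKg mulVg.
- by move=> [] /esym/n_Sn.
Qed.

Lemma rm_inj i (w : word) : injective (fun c => rm i c w).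
Proof.
move=> c d /(congr1 (rm i c^-1)); rewrite rmK rmM => /esym/rm_free/eqP.
by rewrite mulg_eq1 invgK => /eqP.
Qed.

End Words.
Arguments word0 {A}.

(** * The twisted group *)

Record int_action (A : groupType) := IntAction {
  int_act :> int -> A -> A;
  int_act0 : forall c, int_act 0%R c = c;
  int_actD : forall m n c, int_act (m + n)%R c = int_act m (int_act n c);
  int_actM : forall n c d, int_act n (c * d) = int_act n c * int_act n d }.

Section Twist.
Variables (A : groupType) (th : int_action A).
Let th0 := int_act0 th.
Let thD := int_actD th.
Let thM := int_actM th.
Implicit Types (i j : bool) (c d : A) (u v w : word A).

Lemma int_act1 n : th n 1 = 1.
Proof. by apply: (mulgI (th n 1)); rewrite -thM !mulg1. Qed.

(* [k i w] is the exponent of [th] in the local action of [f] at the vertex of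
   the Bass-Serre tree given by the coset of [w] modulo the factor [i]. *)
Definition cocycle (f : word A -> word A) (k : bool -> word A -> int) :=
  (forall i c w, f (rm i c w) = rm i (th (k i w) c) (f w)) /\
  (forall i c w, k i (rm i c w) = k i w).

(** Every word is reached from the empty one by right multiplications, whose effect is governed by
    the cocycle. Most identities between bijections of words reduce to this. *)
Lemma cocycle_eq f g k l : cocycle f k -> cocycle g l ->
  (forall i w, k i w = l i w) -> f word0 = g word0 -> f =1 g.
Proof.
move=> [fk _] [gl _] kl fg0; elim/word_ind => // i c w _ _ fgw.
by rewrite fk gl fgw kl.
Qed.

Lemma cocycle_id : cocycle id (fun _ _ => 0%R).
Proof. by split=> // i c w; rewrite th0. Qed.

Lemma cocycle_comp f g k l : cocycle f k -> cocycle g l ->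
  cocycle (f \o g) (fun i w => (k i (g w) + l i w)%R).
Proof.
move=> [fk kI] [gl lI]; split=> i c w /=; first by rewrite gl fk thD.
by rewrite gl kI lI.
Qed.

Lemma cocycle_inv (p : bij (word A)) k : cocycle p k ->
  cocycle ((p^-1)%g : bij _) (fun i w => - k i (((p^-1)%g : bij _) w))%R.
Proof.
move=> [pk kI].
have pV w : p (((p^-1)%g : bij _) w) = w := bij_invK p w.
have E i c w : ((p^-1)%g : bij _) (rm i c w) =
    rm i (th (- k i (((p^-1)%g : bij _) w))%R c) (((p^-1)%g : bij _) w).
  by apply: (can_inj (@bij_funK _ p)); rewrite pV pk -thD GRing.subrr th0 pV.
by split=> // i c w; rewrite E kI.
Qed.

(** The map with prescribed cocycle [k] and prescribed value [u] at the empty word: each letter is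
    twisted by the exponent at the vertex where it is attached. *)
Fixpoint walk_seq u (k : bool -> seq (bool * A) -> int) (s : seq (bool * A)) :=
  if s is (i, c) :: s' then rm i (th (k i s') c) (walk_seq u k s') else u.

Definition walk u k w := walk_seq u k w.

(** If [w] already ends in factor [i], its last letter merges with [c]. Both are attached at the
    same vertex, so their exponents agree and multiplicativity of [th] recombines them. *)
Lemma cocycle_walk u (k : bool -> seq (bool * A) -> int) :
  (forall i c w, k i (rm i c w) = k i w) -> cocycle (walk u k) k.
Proof.
move=> kI; split=> // i c w.
have Wcons d v : ~~ ends i v ->
    walk u k (rm i d v) = rm i (th (k i v) d) (walk u k v).
  move=> ev; have [->|d1] := eqVneq d 1; first by rewrite int_act1 !rm1.
  by rewrite /walk rm_cons.
have [[w' [d [d1 ew ->]]]|ew] : (exists w' d, [/\ d != 1, ~~ ends i w' & w = rm i d w'])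
    \/ ~~ ends i w; last exact: Wcons.
  have [ew|] := boolP (ends i w); [left|by right].
  case: (wordP w) ew => [->//|[j [d [w' [d1 ew ->]]]]].
  by rewrite rm_cons //= => /eqP <-; exists w', d.
by rewrite rmM !Wcons // kI thM rmM.
Qed.

Lemma walk0K i c : cancel (walk (rm i c word0) (fun _ _ => 0%R))
                          (walk (rm i c^-1 word0) (fun _ _ => 0%R)).
Proof.
move=> w; have K d := @cocycle_walk (rm i d word0) (fun _ _ => 0%R) (fun _ _ _ => erefl).
have E := cocycle_eq (cocycle_comp (K c^-1) (K c)) cocycle_id (fun _ _ => erefl).
by apply: (E _ w); rewrite /= (K _).1 th0 rmM mulVg rm1.
Qed.

Fact walk0VK i c : cancel (walk (rm i c^-1 word0) (fun _ _ => 0%R))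
                          (walk (rm i c word0) (fun _ _ => 0%R)).
Proof. by have := @walk0K i c^-1; rewrite invgK. Qed.

(** Left multiplication by a letter is the only map that commutes with all right multiplications and
    sends the empty word to that letter; hence the zero cocycle. *)
Definition lmul i c : bij (word A) := Bij (@walk0K i c) (@walk0VK i c).

Lemma cocycle_lmul i c : cocycle (lmul i c) (fun _ _ => 0%R).
Proof. exact: cocycle_walk. Qed.

Lemma lmul0 i c : lmul i c word0 = rm i c word0. Proof. by []. Qed.

Lemma lmulM i c d : lmul i (c * d) = lmul i c * lmul i d.
Proof.
apply: bijP.
apply: (cocycle_eq (cocycle_lmul i (c * d)) (cocycle_comp (cocycle_lmul i c) (cocycle_lmul i d))) => //.
by rewrite /comp lmul0 -[lmul i d word0]/(rm i d word0) (cocycle_lmul i c).1 th0 lmul0 rmM.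
Qed.

Lemma int_act_neq1 n c : c != 1 -> th n c != 1.
Proof.
by apply: contra => /eqP thc; rewrite -(th0 c) -(GRing.addNr n) thD thc int_act1.
Qed.

(** The first letter of a word is the last entry of its list. *)
Definition starts i (s : seq (bool * A)) :=
  if s is x :: s' then (last x s').1 == i else false.

Lemma reduced_cat (z s : seq (bool * A)) j :
  reduced (z ++ s) -> starts j z -> ~~ ends j s.
Proof.
elim: z => // -[i c] [|y z] IH /and3P[_ ei rz] //=; last exact: IH.
by move=> /eqP <-.
Qed.

Lemma reduced_rcons (z : seq (bool * A)) i c : reduced (rcons z (i, c)) ->
  [/\ reduced z, c != 1 & forall j, starts j z -> j != i].
Proof.
move=> rz; split=> [||j sj]; last first.
- by rewrite eq_sym; move: rz sj; rewrite -cats1; exact: reduced_cat.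
- by elim: z rz => [|[j d] y IH] /and3P[].
elim: z rz => // -[j d] y IH /and3P[d1 ey /IH ry] /=.
by rewrite d1 ry andbT; case: (y) ey => //= -[].
Qed.

(** Powers of [th] keep nontrivial letters nontrivial, so once the first letter of [z] does not
    merge with the end of [f w], nothing cancels later on. The last clause covers exponents that
    vanish at all vertices beyond [w]: there the tail is copied unchanged. *)
Lemma cocycle_cat f k (z : seq (bool * A)) v w : cocycle f k ->
    v = z ++ w :> seq _ -> (forall i, starts i z -> ~~ ends i (f w)) ->
  exists z', [/\ f v = z' ++ f w :> seq _, map fst z' = map fst z
    & (forall j u, suffix w u -> ~~ ends j u -> k j u = 0%R) -> z' = z].
Proof.
move=> [fk _]; elim: z v => [|[i c] z IH] v.
  by move=> ev _; exists [::]; rewrite (val_inj ev : v = w).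
case: v => v rv /= ev; subst v => sz.
have /and3P[c1 ezw rzw] := rv.
have [j sj|z' [fz' shz kz]] := IH (Word rzw) erefl.
  by apply: sz; case: (z) sj.
exists ((i, th (k i (Word rzw)) c) :: z').
have -> : Word rv = rm i c (Word rzw).
  by apply: val_inj; exact: esym (@rm_cons _ i c (Word rzw) ezw c1).
split=> [||k0].
- rewrite fk rm_cons ?fz' ?int_act_neq1 //.
  case: (z) (z') shz ezw sz => [|[i1 c1'] z1] [|[i2 c2] z2] //=.
    by move=> _ _ /(_ i); apply; rewrite eqxx.
  by case=> ->.
- by rewrite /= shz.
- by rewrite (kz k0) k0 ?th0 // suffix_suffix.
Qed.

Lemma cocycle_shape f k w : cocycle f k -> f word0 = word0 ->
  map fst (f w) = map fst w.
Proof.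
move=> fk f0; have [|i _|z [-> <- _]] := cocycle_cat (z := w) (v := w) (w := word0) fk.
- by rewrite cats0.
- by rewrite f0.
- by rewrite f0 cats0.
Qed.

(** Indicator of one vertex: the coset of the empty word modulo the factor [false], made of the
    words of length at most one in that factor. *)
Definition rootcoset (i : bool) (s : seq (bool * A)) : bool :=
  ~~ i && (map fst s \in [:: [::]; [:: false]]).

Lemma rootcosetP i w : rootcoset i w -> i = false /\ exists c, w = rm i c word0.
Proof.
rewrite /rootcoset; case: i => //=; rewrite !inE.
case: w => -[|[j c] [|? ?]] //= rw; last by case/eqP.
  by move=> _; split=> //; exists 1; apply: val_inj; rewrite /= /rmul eqxx.
move=> /eqP [ej]; subst j; split=> //; exists c.
have /andP[/negPf c1 _] := rw.
by apply: val_inj; rewrite /= /rmul /= c1.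
Qed.

Lemma rootcoset_rm i c w : rootcoset i (rm i c w) = rootcoset i w.
Proof.
have R d : rootcoset false (rm false d word0).
  by rewrite /= /rmul /=; case: ifP; rewrite /rootcoset.
apply/idP/idP => /[dup] /rootcosetP[ei [d]]; subst i.
  by move=> e _; rewrite -(rmK false c w) e rmM R.
by move=> -> _; rewrite rmM R.
Qed.

(** This is [c w |-> th^n(c) w], for a first letter [c] in the factor [false]. *)
Definition twist_walk (n : int) :=
  walk word0 (fun i s => if rootcoset i s then n else 0%R).

Fact cocycle_twist_walk n :
  cocycle (twist_walk n) (fun i w => if rootcoset i w then n else 0%R).
Proof. by apply: cocycle_walk => i c w; rewrite rootcoset_rm. Qed.

(** Maps that fix the empty word preserve shapes, hence the root vertex, so the exponents there add
    up. *)
Fact twist_walkD m n w : twist_walk m (twist_walk n w) = twist_walk (m + n) w.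
Proof.
have Km := cocycle_twist_walk m; have Kn := cocycle_twist_walk n.
apply: (cocycle_eq (cocycle_comp Km Kn) (cocycle_twist_walk _)) w => // i w.
rewrite {1}/rootcoset.
by rewrite (cocycle_shape w Kn) // -/(rootcoset i w); case: rootcoset; rewrite ?GRing.addr0.
Qed.

Fact twist_walk_id w : twist_walk 0 w = w.
Proof.
by apply: (cocycle_eq (cocycle_twist_walk 0) cocycle_id) w => // i w; case: ifP.
Qed.

Fact twist_walkK n : cancel (twist_walk n) (twist_walk (- n)).
Proof. by move=> w; rewrite twist_walkD GRing.addNr twist_walk_id. Qed.

Fact twist_walkVK n : cancel (twist_walk (- n)) (twist_walk n).
Proof. by move=> w; rewrite twist_walkD GRing.addrN twist_walk_id. Qed.

Definition twist : bij (word A) := Bij (@twist_walkK 1) (@twist_walkVK 1).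

Lemma cocycle_twist : cocycle twist (fun i w => if rootcoset i w then 1%R else 0%R).
Proof. exact: cocycle_twist_walk. Qed.

(** The list [l] contains a representative of every vertex with nonzero exponent, so the support is
    finite. *)
Definition tame (f : word A -> word A) := exists k (l : seq (word A)),
  cocycle f k /\ forall i w, k i w <> 0%R -> exists2 v, v \in l & exists c, w = rm i c v.

Lemma is_subgroup_tame : is_subgroup [set p : bij (word A) | tame p].
Proof.
split=> /=.
- by exists (fun _ _ => 0%R), [::]; split=> //; exact: cocycle_id.
- move=> p q [k [l [pk kl]]] [k' [l' [qk' k'l']]].
  (* The exponents of [p] are read at [q w], so their support is pulled back along [q]. *)
  exists (fun i w => k i (q w) + k' i w)%R, (map (bij_inv q) l ++ l').
  split; first exact: (cocycle_comp pk qk').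
  move=> i w kk'; have [k'0|k'0] := eqVneq (k' i w) 0%R; last first.
    by have [v vl vw] := k'l' _ _ (elimN eqP k'0); exists v; rewrite // mem_cat vl orbT.
  have [|v vl [c qw]] := kl i (q w); first by move: kk'; rewrite k'0 GRing.addr0.
  exists (bij_inv q v); first by rewrite mem_cat map_f.
  have E := (cocycle_inv qk').1 i c v; rewrite -qw [LHS]bij_funK in E.
  by rewrite E; eexists.
- move=> p [k [l [pk kl]]].
  exists (fun i w => - k i (bij_inv p w))%R, (map p l).
  split; first exact: (cocycle_inv pk).
  move=> i w k0; have [|v vl [c pw]] := kl i (bij_inv p w).
    by move: k0 => /[swap] ->; rewrite GRing.oppr0.
  exists (p v); first exact: map_f.
  by rewrite -(bij_invK p w) pw pk.1; eexists.
Qed.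

Lemma tame_lmul i c : tame (lmul i c).
Proof. by exists (fun _ _ => 0%R), [::]; split=> //; exact: cocycle_lmul. Qed.

Lemma tame_twist : tame twist.
Proof.
eexists _, [:: word0]; split; first exact: cocycle_twist.
move=> i w /=; case: ifP => // /rootcosetP[_ [c ->]] _.
by exists word0; [exact: mem_head|exists c].
Qed.

Definition twist_generators : set (bij (word A)) :=
  [set p | p = twist \/ exists i c, p = lmul i c].

Definition twist_group := subgrp twist_generators.

Fact lmul_generated i c : lmul i c \in generated twist_generators.
Proof. by apply/asboolP; apply: sub_gen_smallest; right; exists i, c. Qed.

Definition tg_lmul i c : twist_group := Subgrp (lmul_generated i c).

Fact twist_generated : twist \in generated twist_generators.
Proof. by apply/asboolP; apply: sub_gen_smallest; left. Qed.

Definition tg_twist : twist_group := Subgrp twist_generated.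

(** Words thereby correspond to cosets of the stabilizer of the empty word. The zero cocycle says
    that [g] can be taken to be a translation. *)
Lemma transitive_twist_group w :
  exists2 g : twist_group, cocycle (val g) (fun _ _ => 0%R) & val g word0 = w.
Proof.
elim/word_ind: w => [|i c w c1 ew [g gk gw]].
  by exists 1; first exact: cocycle_id.
exists (g * tg_lmul i c); first exact: (cocycle_comp gk (cocycle_lmul i c)).
by rewrite -[LHS]/(val g (rm i c word0)) gk.1 th0 gw.
Qed.

Lemma tame_twist_group (g : twist_group) : tame (val g).
Proof.
case: g => p gp /=.
refine (@smallest_sub _ (@is_subgroup _) _ [set p : bij (word A) | tame p]
  is_subgroup_tame _ p (asboolW gp)).
by move=> _ [->|[i [c ->]]]; [exact: tame_twist|exact: tame_lmul].
Qed.

End Twist.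

(** * Torsion *)

Section TorsionFree.
Variables (A : groupType) (th : int_action A).
Hypothesis th_faithful : forall n, (forall c, th n c = c) -> n = 0%R.
Hypothesis A_torsion_free : torsion_free A.

Lemma bijX (T : Type) (p : bij T) n x : (p ^+ n)%g x = iter n p x.
Proof. by elim: n x => // n IH x; rewrite expgS iterS -IH. Qed.

(** The coset of [w] is preserved, and [p] acts on it as the affine map [d |-> c * th^k(d)] with
    [k = k i w]. In the n-th power the linear part gives [n k = 0]; then [k = 0], and the
    translation part gives [c ^ n = 1]. *)
Lemma coset_torsion (p : bij (word A)) k i c w n : cocycle th p k ->
  (0 < n)%N -> p ^+ n = 1 -> p w = rm i c w -> c = 1 /\ k i w = 0%R.
Proof.
move=> [pk kI] n0 pn pw.
have piter m d : iter m p (rm i d w) =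
    rm i (iter m (fun d => c * th (k i w) d) 1 * th (k i w *+ m)%R d) w.
  elim: m d => [|m IH] d; first by rewrite GRing.mulr0n int_act0 mul1g.
  rewrite iterS IH pk pw rmM /= int_actM -int_actD GRing.mulrS.
  by rewrite -mulgA.
have pid d : iter n (fun d => c * th (k i w) d) 1 * th (k i w *+ n)%R d = d.
  by apply: (@rm_inj _ i w); rewrite -piter -bijX pn.
have F1 : iter n (fun d => c * th (k i w) d) 1 = 1.
  by have := pid 1; rewrite int_act1 mulg1.
have k0 : k i w = 0%R.
  have /eqP : (k i w *+ n)%R = 0%R.
    by apply: th_faithful => d; rewrite -[RHS]pid F1 mul1g.
  by rewrite mulrn_eq0 eqn0Ngt n0 => /eqP.
split=> //; apply: (A_torsion_free n0); rewrite -[RHS]F1 k0.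
by elim: (n) => // m IH; rewrite expgS IH iterS int_act0.
Qed.

Lemma cocycle_torsion_fix (p : bij (word A)) k n : cocycle th p k ->
  (0 < n)%N -> p ^+ n = 1 -> p word0 = word0 -> p = 1.
Proof.
move=> pk n0 pn p0; apply: bijP; elim/word_ind => // i c w _ _ pw.
have [|_ k0] := coset_torsion (i := i) (c := 1) (w := w) pk n0 pn.
  by rewrite pw rm1.
by rewrite pk.1 k0 int_act0 pw.
Qed.

Lemma lmul_rcons i c (v : word A) z : v = rcons z (i, c) :> seq _ ->
  lmul th i c^-1 v = z :> seq _.
Proof.
move=> ev; have [|rz c1 zi] := @reduced_rcons _ z i c; first by rewrite -ev; case: (v).
have [j sj|z' [ez' _ kz]] := cocycle_cat (z := z) (v := Word rz) (w := word0)
    (cocycle_lmul th i c) (esym (cats0 z)).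
  by rewrite lmul0 rm_cons //= eq_sym zi.
have -> : v = lmul th i c (Word rz).
  by apply: val_inj; rewrite /= ez' kz // lmul0 rm_cons // ev cats1.
by rewrite -[lmul th i c^-1 _]/(bij_inv (lmul th i c) _) bij_funK.
Qed.

(** Induction on the length of [p word0]. If its first and last letters lie in the same factor,
    conjugation by the first letter shortens it; otherwise it is cyclically reduced, and the lengths
    of the iterates grow linearly. *)
Lemma cocycle_torsion (p : bij (word A)) k n : cocycle th p k ->
  (0 < n)%N -> p ^+ n = 1 -> p = 1.
Proof.
move=> pk n0 pn; have [m] := ubnP (size (p word0)).
elim: m p k pk pn => // m IH p k pk pn.
have [s0|] := eqVneq (size (p word0)) 0%N.
  by move=> _; apply: (cocycle_torsion_fix pk n0 pn); apply: val_inj; exact: size0nil.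
case eu: (wseq (p word0)) => [//|[i e] u'] _.
case/lastP: u' eu => [|z [j c]] eu.
  (* A single letter means that [p] fixes a vertex containing the empty word. *)
  have [|e1 _] := coset_torsion (i := i) (c := e) (w := word0) pk n0 pn.
    have := valP (p word0); rewrite /= eu => /and3P[e1 _ _].
    by apply: val_inj; exact: etrans eu (esym (@rm_cons _ i e word0 isT e1)).
  by have := valP (p word0); rewrite /= eu e1 /= eqxx.
have [ij|ij] := eqVneq i j.
  subst j => sm; pose q := (lmul th i c^-1 * p * lmul th i c)%g.
  have lV : lmul th i c^-1 * lmul th i c = 1.
    rewrite -lmulM mulVg; apply: bijP.
    apply: (cocycle_eq (cocycle_lmul th i 1) (cocycle_id th)) => //.
    by rewrite lmul0 rm1.
  have qE : q = p ^ lmul th i c.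
    by rewrite /q conjgE -mulgA; congr (_ * _); apply/eqP; rewrite -mulg_eq1 lV.
  suff q1 : q = 1 by move: qE; rewrite q1 => /esym/eqP; rewrite conjg_eq1 => /eqP.
  apply: (IH q _ (cocycle_comp (cocycle_comp (cocycle_lmul th i c^-1) pk) (cocycle_lmul th i c))).
    by rewrite qE -conjXg pn conj1g.
  have -> : q word0 = lmul th i c^-1 (rm i (th (k i word0) c) (p word0)).
    by rewrite -pk.1.
  (* The twisted [c] is absorbed by the last letter of [p word0], so stripping the first letter
     makes the word strictly shorter. *)
  have [y [ey sy]] : exists y, rm i (th (k i word0) c) (p word0) = rcons y (i, c) :> seq _
       /\ (size y < size (p word0))%N.
    rewrite /= /rmul eu /= eqxx size_rcons; case: ifP => _; first by exists z.
    by eexists (_ :: z); split; [rewrite rcons_cons|].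
  rewrite (lmul_rcons ey); apply: leq_trans sy _.
  by rewrite -ltnS; apply: leq_trans sm; rewrite eu.
move=> _; suff sz r : size (iter r p word0) = (r * size (p word0))%N /\
    (forall j', starts j' (iter r p word0) -> j' = j).
  by have := (sz n).1; rewrite -bijX pn /= eu; case: (n) n0.
elim: r => // r [IHs IHj]; rewrite iterS.
have [j' /IHj ->|x [ex shx _]] := cocycle_cat (z := iter r p word0) (v := iter r p word0)
   (w := word0) pk (esym (cats0 _)); first by rewrite eu.
have -> : size (p (iter r p word0)) = (size x + size (p word0))%N by rewrite ex size_cat.
rewrite -(size_map fst) shx size_map IHs mulSn addnC; split=> // j'.
rewrite ex eu; case: x {ex shx} => [|y x] /=; rewrite ?last_cat /= last_rcons /=;
 by move/eqP.
Qed.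

Lemma torsion_free_twist_group : torsion_free (twist_group th).
Proof.
move=> g n n0 gn; have [k [_ [gk _]]] := tame_twist_group g.
apply: val_inj; apply: (cocycle_torsion gk n0).
by rewrite -gmulfXn gn.
Qed.

End TorsionFree.

(** * Amenable radical *)

Section AmenableRadical.
Variables (R : realType) (G : groupType) (X : Type) (act : G -> X -> X) (o : X).
Hypothesis act1 : forall x, act 1 x = x.
Hypothesis actM : forall g h x, act (g * h) x = act g (act h x).

(** A mean on a normal subgroup is pushed to [X] along the orbit of [o]. If [g] moves the complement
    of [V i] into [U], then [n ^ g] moves that complement off itself, so the complement has mean at
    most 1/2. Three disjoint sets of mean at least 1/2 cannot exist. *)
Lemma trivial_amenable_radical_of_action :
  (forall n : G, n <> 1 -> exists U : set X,
    (forall x, U x -> ~ U (act n x)) /\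
    exists V : 'I_3 -> set X, (forall i j x, V i x -> V j x -> i = j) /\
      forall i, exists g, forall x, ~ V i x -> U (act g x)) ->
  trivial_amenable_radical R G.
Proof.
move=> extr; split.
- split=> [|g _ ->]; last by rewrite /= conj1g.
  by split=> //= [_ _ -> ->|_ ->]; rewrite ?mulg1 ?invg1.
(* The point mass at the identity. *)
- exists (fun A : set G => if `[< A 1 >] then 1%R else 0%R); split.
  + by move=> A _; case: ifP.
  + by rewrite asboolT.
  + move=> A B _ _ AB0 /=; have nAB : ~ (A 1 /\ B 1) by rewrite -[_ /\ _]/((A `&` B) 1) AB0.
    have -> : `[< (A `|` B) 1 >] = `[< A 1 >] || `[< B 1 >] by exact: asbool_or.
    case: (asboolP (A 1)) => a; case: (asboolP (B 1)) => b /=; rewrite ?GRing.addr0 ?GRing.add0r //.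
    by case: nAB.
  + move=> h A h1 _; rewrite (_ : [set h * a | a in A] = A) // h1.
    by apply/seteqP; split=> [_ [a Aa <-]|a Aa]; [|exists a]; rewrite ?mul1g.
move=> M [[M1 MM MV] MJ] [mu [mu0 mu1 muD muI]] n Mn /=; apply: contrapT => n1.
have [U [nU [V [Vdisj gV]]]] := extr n n1.
pose pre (Y : set X) : set G := [set m | M m /\ Y (act m o)].
have preM Y : pre Y `<=` M by move=> m [].
pose nu Y := mu (pre Y).
have nu0 Y : (0 <= nu Y)%R by apply: mu0.
have nuD Y Z : (forall x, Y x -> ~ Z x) -> nu (Y `|` Z) = (nu Y + nu Z)%R.
  move=> YZ; rewrite /nu -muD //; first congr mu.
    apply/seteqP; split=> [m [Mm [Ym|Zm]]|m [[Mm Ym]|[Mm Zm]]].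
    - by left.
    - by right.
    - by split=> //; left.
    - by split=> //; right.
  by apply/seteqP; split=> // m [[_ Ym] [_ Zm]]; exact: YZ Ym Zm.
have nuT : nu setT = 1%R.
  by rewrite /nu -mu1; congr mu; apply/seteqP; split=> m //= [].
have nuI h Y : M h -> nu [set x | Y (act h^-1 x)] = nu Y.
  move=> Mh; rewrite /nu -(muI h (pre Y)) //; congr mu.
  apply/seteqP; split=> [m /= [Mm Ym]|_ [m [Mm Ym] <-]].
    exists (h^-1 * m); last by rewrite mulVKg.
    by split; [apply: MM => //; exact: MV|rewrite actM].
  by split; [exact: MM|rewrite /= -actM mulKg].
have nu_le Y Z : (forall x, Y x -> ~ Z x) -> (nu Y + nu Z <= 1)%R.
  move=> YZ; rewrite -nuT -(setvU (Y `|` Z)) nuD; last by move=> x nx yz; exact: nx.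
  by rewrite -nuD // lerDr.
have nuV i : (2^-1 <= nu (V i))%R.
  have [g gVU] := gV i.
  have Mh : M (n ^ g)^-1 by apply: MV; exact: MJ.
  have nC : (nu (~` V i) + nu (~` V i) <= 1)%R.
    rewrite -{2}(nuI _ _ Mh); apply: nu_le => x Vx /=; rewrite invgK => Vnx.
    apply: (nU (act g x)); first exact: gVU.
    rewrite -actM (_ : n * g = g * n ^ g); last by rewrite conjgE mulVKg.
    by rewrite actM; exact: gVU.
  have := nuD (V i) (~` V i) (fun x Vx nVx => nVx Vx).
  rewrite setUv nuT => e; lra.
pose i0 : 'I_3 := inord 0; pose i1 : 'I_3 := inord 1; pose i2 : 'I_3 := inord 2.
have ne (a b : nat) : (a < 3)%N -> (b < 3)%N -> a <> b -> inord a <> inord b :> 'I_3.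
  by move=> a3 b3 ab /(congr1 val); rewrite /= !inordK.
have d01 : nu (V i0 `|` V i1) = (nu (V i0) + nu (V i1))%R.
  by apply: nuD => x V0 V1; apply: (ne 0 1)%N => //; exact: Vdisj V0 V1.
have : (nu (V i0 `|` V i1) + nu (V i2) <= 1)%R.
  apply: nu_le => x [V0|V1] V2.
    by apply: (ne 0 2)%N => //; exact: Vdisj V0 V2.
  by apply: (ne 1 2)%N => //; exact: Vdisj V1 V2.
rewrite d01; move: (nuV i0) (nuV i1) (nuV i2); lra.
Qed.

End AmenableRadical.

Lemma inj_avoid (T : eqType) (f : nat -> T) (l : seq T) : injective f ->
  exists N, forall n, (N <= n)%N -> f n \notin l.
Proof.
move=> finj; elim: l => [|x l [N IH]]; first by exists 0%N.
have [[m fm]|nf] := pselect (exists m, f m = x).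
  exists (maxn N m.+1) => n; rewrite geq_max => /andP[Nn mn].
  rewrite inE negb_or IH // andbT; apply: contraTneq mn => fn.
  by rewrite -leqNgt (finj n m) // fm.
exists N => n Nn; rewrite inE negb_or IH // andbT; apply/eqP => fn.
by apply: nf; exists n.
Qed.

(** * Cones of words *)

Section Proximal.
Variables (A : groupType) (th : int_action A) (mv : nat -> A).
Hypothesis mv_inj : injective mv.
Hypothesis mv_neq1 : forall n, mv n != 1.
Hypothesis mv_moved : forall e k m n, m <> n ->
  e * th k (mv m) = mv m -> e * th k (mv n) = mv n -> e = 1.
Implicit Types (x y w : word A).

(** Words being stored backwards, [suffix s x] says that [x] begins with [s]; the words with suffix
    [w] form the cone at [w]. *)
Lemma suffix_rm i c y s : suffix s (rm i c y) -> s = rm i c y :> seq _ \/ suffix s y.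
Proof.
have cons (a : bool * A) t : suffix s (a :: t) -> s = a :: t \/ suffix s t.
  case/suffixP => -[|b u] /= [->]; first by left.
  by move=> ->; right; exact: suffix_suffix.
rewrite /= /rmul; case: ifP => _; last by case: ifP => _; [right|exact: cons].
case: y => -[|a t] _ /=; case: ifP => _; try exact: cons.
- by right.
- by move=> st; right; apply: suffix_trans st _; exact: suffix_cons.
- by case/cons; [left|move=> st; right; apply: suffix_trans st _; exact: suffix_cons].
Qed.

Lemma ends_rm_or i c y : ends i (rm i c y) \/ suffix (rm i c y) y.
Proof.
rewrite /= /rmul; case: y => -[|[j d] y] _ /=.
  by case: ifP; [right|left; rewrite /= eqxx].
case: ifP => _; case: ifP => _; do ?by left; rewrite /= eqxx.
  by right; exact: suffix_cons.
by right; exact: suffix_refl.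
Qed.

Lemma rm_suffix i c y : ~~ ends i y -> suffix y (rm i c y).
Proof.
move=> ey; have [->|c1] := eqVneq c 1; first by rewrite rm1 suffix_refl.
by rewrite rm_cons // suffix_cons.
Qed.

Lemma suffix_total (T : eqType) (s1 s2 t : seq T) : suffix s1 t -> suffix s2 t ->
  suffix s1 s2 \/ suffix s2 s1.
Proof.
wlog le12 : s1 s2 / (size s1 <= size s2)%N => [hw|/suffixP[u1 e1] /suffixP[u2 e2]].
  by case: (leqP (size s1) (size s2)) => [|/ltnW] h h1 h2; have [] := hw _ _ h; tauto.
left; apply/suffixP; exists (drop (size u2) u1).
have le_u : (size u2 <= size u1)%N.
  have := congr1 size e1; rewrite e2 !size_cat; lia.
have := congr1 (drop (size u2)) e1; rewrite e2 drop_size_cat // drop_cat.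
rewrite ltn_neqAle le_u andbT; case: eqVneq => //= e.
by rewrite e subnn drop0 drop_size => ->.
Qed.

(** A moved word [x] is extended by a letter [mv n] with [n] large. Beyond the support of the
    cocycle, [p] carries the cone at [W n] rigidly into the cone at [p (W n)]. Cones are nested or
    disjoint, and nesting is excluded by avoiding the finitely many initial parts of [x] and
    [p x]. *)
Lemma moved_cone (p : bij (word A)) : tame th p -> p <> 1 ->
  exists i w, ends i w /\ forall x, suffix w x -> ~ suffix w (p x).
Proof.
move=> [k [l [pk kl]]] p1.
have [x px] : exists x, p x <> x.
  apply: contrapT => nx; apply: p1; apply: bijP => x /=.
  by apply: contrapT => px; apply: nx; exists x.
have [i ex] : exists i, ~~ ends i x.
  by case: (x) => -[|[j c] s] _ /=; [exists true|exists (~~ j); case: j].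
pose W n := rm i (mv n) x.
have Winj : injective W by move=> m n /rm_inj/mv_inj.
have pW n : p (W n) = rm i (th (k i x) (mv n)) (p x) by rewrite /W pk.1.
pose suffixes (s : seq (bool * A)) := [seq drop n s | n <- iota 0 (size s).+1].
have suffixesP s t : suffix s t -> s \in suffixes t.
  case/suffixP => u ->; apply/mapP; exists (size u).
    by rewrite mem_iota /= size_cat ltnS leq_addr.
  by rewrite drop_size_cat.
have [N1 W1] := inj_avoid (flatten [seq suffixes (wseq v) | v <- p x :: l])
   (inj_comp (@val_inj _ _ (word A)) Winj).
have [N2 W2] := inj_avoid (suffixes x ++ suffixes (p x))
   (inj_comp (@val_inj _ _ (word A)) (inj_comp (can_inj (@bij_funK _ p)) Winj)).
(* If all late [W n] were fixed, [p x] would be [x] times a letter [e], and [mv_moved] would force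
   [e = 1]. *)
have [n [n1 n2 pWn]] : exists n, [/\ (N1 <= n)%N, (N2 <= n)%N & p (W n) <> W n].
  pose m := maxn N1 N2; apply: contrapT => nn.
  have fixW n : (m <= n)%N -> p (W n) = W n.
    by rewrite geq_max => /andP[? ?]; apply: contrapT => pW'; apply: nn; exists n.
  pose e := mv m * (th (k i x) (mv m))^-1.
  have pxe : p x = rm i e x.
    by rewrite -(rmM i _ (mv m)) -/(W m) -fixW // pW rmK.
  have fixmv n : (m <= n)%N -> e * th (k i x) (mv n) = mv n.
    by move/fixW; rewrite pW pxe rmM => /rm_inj.
  have e1 : e = 1 by apply: (mv_moved (n_Sn m)); apply: fixmv.
  by apply: px; rewrite pxe e1 rm1.
have {W1}W1 v : v \in p x :: l -> ~~ suffix (W n) v.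
  move=> vl; apply: contra (W1 n n1) => /suffixesP sv.
  by apply/flattenP; exists (suffixes v) => //; apply/mapP; exists v.
have {W2}[W2 W3] : ~~ suffix (p (W n)) x /\ ~~ suffix (p (W n)) (p x).
  have := W2 n n2; rewrite mem_cat negb_or => /andP[h1 h2].
  by split; [apply: contra h1|apply: contra h2] => /suffixesP.
have eW : ends i (W n) by rewrite ends_rm.
(* Otherwise the last letter cancels and [p (W n)] is an initial part of [p x]. *)
have epW : ends i (p (W n)).
  by move: W3; rewrite pW; case: (ends_rm_or i (th (k i x) (mv n)) (p x)) => // ->.
exists i, (W n); split=> // v /suffixP[z ev] svW.
have [j sj|z' [epv _ ez']] := cocycle_cat pk ev.
  apply/negP => ej; have ij := ends_uniq epW ej; subst j.
  have rv : reduced (z ++ W n) by rewrite -ev; case: (v).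
  by have := reduced_cat rv sj; rewrite ends_rm.
have {}epv : p v = z ++ p (W n) :> seq _.
  (* A nonzero exponent beyond [W n] would make [W n] an initial part of an entry of [l]. *)
  rewrite epv ez' // => j u su eu; apply: contrapT => /kl[v' v'l [c eu']].
  have /= := W1 v'; rewrite inE v'l orbT => /(_ isT)/negP; apply.
  have : suffix u (rm j c^-1 u) by rewrite rm_suffix.
  by rewrite {2}eu' rmK; exact: suffix_trans.
have sp : suffix (p (W n)) (p v) by rewrite epv suffix_suffix.
have [uw|wu] := suffix_total sp svW.
  by case: (suffix_rm uw) => [/val_inj|]; [exact: pWn|exact/negP].
move: (wu); rewrite {1}pW => /suffix_rm[/val_inj|]; last first.
  by apply/negP/W1; exact: mem_head.
by rewrite -pW => /esym.
Qed.

(** The letter [d] may be 1, so that one form serves words starting in factor [i] and all others. *)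
Lemma first_letter i w : exists z d, [/\ w = z ++ rm i d word0 :> seq _,
  forall j, starts j z -> j != i & d = 1 \/ suffix [:: (i, d)] w].
Proof.
have N z : ~~ starts i z -> forall j, starts j z -> j != i.
  by move=> nz j sj; apply: contraNneq nz => <-.
case: w => w rw; case/lastP: w rw => [|z [j d]] rw.
  by exists [::], 1; split; [rewrite rm1|by []|left].
have [rz d1 zj] := reduced_rcons rw.
have [ij|ij] := eqVneq i j; last first.
  exists (rcons z (j, d)), 1; split; [by rewrite rm1 cats0| |by left].
  apply: N; rewrite /starts; case: (z) => [|? ?] /=; rewrite ?last_rcons /=;
    by rewrite eq_sym.
subst j; exists z, d; rewrite rm_cons // cats1; split=> //; right.
by rewrite /= -cats1 suffix_suffix.
Qed.

(** Outside the cone of [mv n], left multiplication by its inverse produces a word starting in the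
    factor [~~ i]. A translation taking the empty word to [w] then puts [w] in front without
    cancellation. *)
Lemma cone_expansion i w n : ends i w -> exists g : twist_group th,
  forall x, ~ suffix [:: (~~ i, mv n)] x -> suffix w (val g x).
Proof.
move=> ew; have [g gk gw] := transitive_twist_group th w.
exists (g * tg_lmul th (~~ i) (mv n)^-1) => x nx.
set y := lmul th (~~ i) (mv n)^-1 x.
rewrite -[X in suffix w X]/(wseq (val g y)).
suff sy : starts (~~ i) y.
  have [j sj|z [-> _ _]] := cocycle_cat (w := word0) gk (esym (cats0 y)); last by rewrite gw suffix_suffix.
  rewrite gw; apply/negP => /(ends_uniq ew) ij; subst j.
  move: sy sj; case: (wseq y) => //= ? ? /eqP -> /eqP.
  by case: (i).
have [z [d [ex zi dx]]] := first_letter (~~ i) x.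
have Ey : lmul th (~~ i) (mv n)^-1 (rm (~~ i) d word0) = rm (~~ i) ((mv n)^-1 * d) word0.
  by rewrite (cocycle_lmul th _ _).1 int_act0 lmul0 rmM.
have nd : (mv n)^-1 * d != 1.
  rewrite mulg_eq1 (inj_eq (@invg_inj _)); apply/eqP => ed.
  case: dx => [d1|]; last by rewrite -ed.
  by have := mv_neq1 n; rewrite ed d1 eqxx.
have [j /zi ji|z' [ey shz _]] := cocycle_cat (cocycle_lmul th (~~ i) (mv n)^-1) ex.
  by rewrite Ey rm_cons //= eq_sym.
rewrite /y ey Ey rm_cons //=; case: (z') => /= [|a z1]; rewrite ?last_cat /= ?eqxx //.
Qed.

Lemma trivial_amenable_radical_twist_group (R : realType) :
  trivial_amenable_radical R (twist_group th).
Proof.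
apply: (@trivial_amenable_radical_of_action R (twist_group th) (word A)
  (fun g w => val g w) word0) => //.
move=> g g1.
have [|i [w [ew wU]]] := moved_cone (tame_twist_group g).
  by move=> vg; apply: g1; apply: val_inj; rewrite vg.
exists [set x : word A | suffix w x]; split; first exact: wU.
exists (fun m => [set x : word A | suffix [:: (~~ i, mv m)] x]).
split=> [m n x /= /suffixP[u ->] /suffixP[v]|m]; last exact: cone_expansion.
rewrite !cats1 => /rcons_inj[_ /mv_inj]; exact: val_inj.
Qed.

End Proximal.

(** * Amenability of stabilizers *)

(* Folner sets with multiplicities: I is the index set of a family f in H, and
   left translation by x agrees with a permutation of I off a small set D. *)
Definition folner (G : groupType) (H : set G) : Prop :=
  forall (s : seq G) (m : nat), (forall x, x \in s -> H x) ->
  exists (I : finType) (f : I -> G), [/\ (0 < #|I|)%N, forall i, H (f i) &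
    forall x, x \in s -> exists (t : I -> I) (D : pred I),
      [/\ injective t, (#|D| * m <= #|I|)%N &
        forall i, ~~ D i -> x * f i = f (t i)]].

Lemma card_pair_pred (I J : finType) (P : pred (I * J)) :
  #|P| = (\sum_i #|[pred j | P (i, j)]|)%N.
Proof.
rewrite -sum1_card; under [RHS]eq_bigr do rewrite -sum1_card.
by rewrite pair_big_dep /=; apply: eq_bigl => -[i j].
Qed.

Lemma is_subgroup_comm (G : groupType) (L : set G) x y :
  is_subgroup L -> L x -> L y -> L [~ x, y].
Proof.
move=> [_ LM LV] Lx Ly.
exact: (LM _ _ (LV _ Lx) (LM _ _ (LV _ Ly) (LM _ _ Lx Ly))).
Qed.

Section FolnerExtension.
Variables (G : groupType) (H N : set G).
Hypothesis H_sub : is_subgroup H.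
Hypothesis N_sub : is_subgroup N.
Hypothesis N_comm : forall x y, H x -> H y -> N [~ x, y].

Let H1 : H 1 := let: And3 h _ _ := H_sub in h.
Let HM x y : H x -> H y -> H (x * y) := let: And3 _ h _ := H_sub in h x y.
Let HV x : H x -> H x^-1 := let: And3 _ _ h := H_sub in h x.
Let N1 : N 1 := let: And3 h _ _ := N_sub in h.
Let NM x y : N x -> N y -> N (x * y) := let: And3 _ h _ := N_sub in h x y.

(** Modulo [N] the group is abelian, so boxes of powers of the elements of [s] are almost invariant.
    Each new [x] contributes exponents from 0 to [m], of which only the top one is exceptional. *)
Lemma folner_mod (s : seq G) (m : nat) : (forall x, x \in s -> H x) ->
  exists (I : finType) (f : I -> G), [/\ (0 < #|I|)%N, forall i, H (f i) &
    forall x, x \in s -> exists (t : I -> I) (D : pred I),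
      [/\ injective t, (#|D| * m <= #|I|)%N &
        forall i, ~~ D i -> N ((f (t i))^-1 * (x * f i))]].
Proof.
elim: s => [|x s IH] Hs.
  by exists unit, (fun=> 1); split=> //; rewrite card_unit.
have [y ys|I [f [I0 Hf fs]]] := IH; first by apply: Hs; rewrite inE ys orbT.
have Hx : H x by apply: Hs; rewrite mem_head.
have HX a : H (x ^+ a) by elim: a => // a Ha; rewrite expgS; exact: HM.
exists ('I_m.+1 * I)%type, (fun p : 'I_m.+1 * I => x ^+ p.1 * f p.2); split=> [|p|y].
- by rewrite card_prod card_ord muln_gt0.
- exact: HM.
rewrite inE; have [-> _|_ /= ys] := eqVneq y x.
  exists (fun p => (ordS p.1, p.2)), [pred p | p.1 == ord_max]; split=> /=.
  - move=> [a i] [b j] e; have /= ej := congr1 snd e.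
    by have /= -> := ordS_inj (congr1 fst e); rewrite ej.
  - rewrite card_pair_pred (bigD1 ord_max) //= big1 => [|a /negPf am].
      rewrite addn0 card_prod card_ord (eq_card (B := I)) => [|i]; last by rewrite inE /= eqxx.
      by rewrite mulnC leq_mul2r leqnSn orbT.
    by apply: eq_card0 => i; rewrite inE /= am.
  - move=> [a i] /= am; have la : (a.+1 < m.+1)%N.
      rewrite ltnS ltn_neqAle -ltnS ltn_ord andbT.
      by apply: contra am => /eqP e; apply/eqP/val_inj.
    by rewrite modn_small // expgS -mulgA mulVg.
have [t [D [tinj cD tN]]] := fs y ys.
exists (fun p => (p.1, t p.2)), [pred p | D p.2]; split=> /=.
- by move=> [a i] [b j] /= [-> /tinj ->].
- rewrite card_pair_pred /= sum_nat_const card_prod card_ord -mulnA leq_mul2l.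
  by apply/orP; right; apply: leq_trans cD; rewrite leq_mul2r (eq_card (B := D)) ?leqnn ?orbT.
- move=> [a i] /= /tN Ni.
  have Hy : H y by apply: Hs; rewrite inE ys orbT.
  (* Moving [y] past [x ^+ a] costs a conjugate of a commutator, which lies in [N]. *)
  have -> : (x ^+ a * f (t i))^-1 * (y * (x ^+ a * f i)) =
      (f (t i))^-1 * (y * f i) * [~ y, x ^+ a] ^ f i.
    by rewrite commgEl !conjgE invgM !mulgA !mulgK.
  apply: NM => //; have Nc := N_comm Hy (HX a).
  have -> : [~ y, x ^+ a] ^ f i = [~ y, x ^+ a] * [~ [~ y, x ^+ a], f i].
    by rewrite commgEl mulVKg.
  by apply: NM => //; apply: N_comm => //; exact: is_subgroup_comm.
Qed.

(** The products [f i * g j] work, with [f] almost invariant modulo [N] and [g] almost invariant in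
    [N] under the finitely many errors [nu x i]. A pair is exceptional through one of its
    coordinates, each with density at most 1/(2m). *)
Lemma folner_extension : N `<=` H -> folner N -> folner H.
Proof.
move=> NH folN s m Hs; have [I [f [I0 Hf fs]]] := folner_mod (2 * m)%N Hs.
have {fs}[t ht] : exists t : G -> (I -> I) * pred I, forall x, x \in s ->
    [/\ injective (t x).1, (#|(t x).2| * (2 * m) <= #|I|)%N &
        forall i, ~~ (t x).2 i -> N ((f ((t x).1 i))^-1 * (x * f i))].
  suff /choice[t ht] : forall x, exists t : (I -> I) * pred I, x \in s ->
    [/\ injective t.1, (#|t.2| * (2 * m) <= #|I|)%N &
        forall i, ~~ t.2 i -> N ((f (t.1 i))^-1 * (x * f i))] by exists t.
  move=> x; have [/fs[t [D h]]|xs] := boolP (x \in s); first by exists (t, D).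
  by exists (id, pred0 : pred I).
pose nu x i := (f ((t x).1 i))^-1 * (x * f i).
have [|J [g [J0 Hg gs]]] :=
    folN [seq nu x i | x <- s, i <- [seq i <- enum I | ~~ (t x).2 i]] (2 * m)%N.
  move=> _ /allpairsPdep[x [i [xs + ->]]]; rewrite mem_filter => /andP[ti _].
  by have [_ _] := ht x xs; exact.
exists (I * J)%type, (fun p : I * J => f p.1 * g p.2); split=> [|p|x xs].
- by rewrite card_prod muln_gt0 I0.
- by apply: HM => //; exact: NH.
have [tinj cD tN] := ht x xs.
have /choice[u hu] : forall i, exists u : (J -> J) * pred J, ~~ (t x).2 i ->
    [/\ injective u.1, (#|u.2| * (2 * m) <= #|J|)%N &
        forall j, ~~ u.2 j -> nu x i * g j = g (u.1 j)].
  move=> i; have [ti|ti] := boolP ((t x).2 i); first by exists (id, pred0 : pred J).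
  have [|v [D h]] := gs (nu x i); last by exists (v, D).
  by apply/allpairsPdep; exists x, i; rewrite mem_filter ti mem_enum.
(* Over an exceptional first index the second one is kept, so that the map stays injective. *)
exists (fun p => ((t x).1 p.1, if (t x).2 p.1 then p.2 else (u p.1).1 p.2)),
  [pred p | (t x).2 p.1 || (u p.1).2 p.2]; split=> /=.
- move=> [a i] [b j] /= [/tinj eab]; subst b; case: ifPn => [_ ->//|ta].
  by have [uinj _ _] := hu a ta => /uinj ->.
- rewrite card_pair_pred card_prod /=.
  have le_i i : (#|[pred j | (t x).2 i || (u i).2 j]| * (2 * m) <=
      ((t x).2 i) * (#|J| * (2 * m)) + #|J|)%N.
    have [ti|ti] := boolP ((t x).2 i); last first.
      rewrite mul0n add0n; have [_ + _] := hu i ti; apply: leq_trans.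
      by rewrite leq_mul2r [X in (_ <= X)%N](eq_card (B := [pred j | (u i).2 j])) ?leqnn ?orbT.
    by rewrite mul1n; apply: leq_trans (leq_addr _ _); rewrite leq_mul2r max_card orbT.
  have := leq_sum (index_enum I) (P := xpredT) (fun i _ => le_i i).
  rewrite -big_distrl /= big_split /= -big_distrl /= sum_nat_const.
  have -> : (\sum_i (t x).2 i)%N = #|(t x).2|.
    by rewrite -sum1_card [RHS]big_mkcond; apply: eq_bigr => i _;
      rewrite -topredE /=; case: ((t x).2 i).
  have : (#|(t x).2| * (#|J| * (2 * m)) <= #|I| * #|J|)%N.
    by rewrite mulnCA mulnC leq_mul2r cD orbT.
  rewrite [X in (X <= _ + _)%N]mulnCA [X in (_ + X * _)%N](eq_card (B := I)) // => le1 le2.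
  rewrite -(leq_pmul2l (isT : (0 < 2)%N)); apply: leq_trans le2 _.
  by rewrite [leqRHS]mul2n -addnn; exact: leq_add le1 (leqnn _).
- move=> [i j] /=; rewrite negb_or => /andP[ti uj]; rewrite (negPf ti).
  have [_ _ /(_ j uj) <-] := hu i ti.
  by rewrite /nu !mulgA mulgV mul1g.
Qed.

End FolnerExtension.

(** * The stabilizer of the empty word as a union of solvable layers *)

Section StabilizerFolner.
Variables (A : groupType) (th : int_action A).
Local Notation G := (twist_group th).
Implicit Types (w : word A) (g h : G).

(* For fixed n, the layers d = n, ..., 0 form an ascending chain of subgroups
   with abelian quotients, starting at the trivial group. *)
Definition layer (n d : nat) : set G := [set g : G | exists k, [/\ cocycle th (val g) k,
  forall w, (size w <= d)%N -> val g w = w &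
  forall i w, ~~ ends i w -> (n <= size w)%N -> k i w = 0%R]].

Lemma ends_shape i (s t : seq (bool * A)) : map fst s = map fst t -> ends i s = ends i t.
Proof. by case: s t => [|[j c] s] [|[j' c'] t] //= [->]. Qed.

Lemma is_subgroup_layer n d : is_subgroup (layer n d).
Proof.
have shape p k w : cocycle th p k -> (forall w, (size w <= d)%N -> p w = w) ->
    map fst (p w) = map fst w.
  by move=> pk pd; apply: (cocycle_shape w pk); exact: pd.
split.
- by exists (fun _ _ => 0%R); split=> //; exact: cocycle_id.
- move=> g h [k [gk gd k0]] [l [hl hd l0]].
  exists (fun i w => k i (val h w) + l i w)%R; split.
  + exact: cocycle_comp gk hl.
  + by move=> w wd; rewrite -[LHS]/(val g (val h w)) hd ?gd.
  + move=> i w ew nw; have shw := shape _ _ w hl hd.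
    by rewrite l0 // k0 ?GRing.addr0 // -?(size_map fst) ?(ends_shape _ shw) ?shw ?size_map.
- move=> g [k [gk gd k0]].
  pose gi : G := g^-1; have gV w : val g (val gi w) = w by exact: bij_invK.
  exists (fun i w => - k i (val gi w))%R; split; rewrite -/gi.
  + exact: cocycle_inv gk.
  + by move=> w wd; rewrite -{1}(gd w wd); exact: bij_funK.
  + move=> i w ew nw; have := shape _ _ (val gi w) gk gd; rewrite gV => shw.
    by rewrite k0 ?GRing.oppr0 // -?(size_map fst) -?(ends_shape _ shw) -?shw ?size_map.
Qed.

Lemma layerS n d : layer n d.+1 `<=` layer n d.
Proof.
by move=> g [k [gk gd k0]]; exists k; split=> // w wd; rewrite gd // (leq_trans wd).
Qed.

(** On a word of length [d.+1] both elements only apply powers of [th] to the last letter, and these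
    powers commute. *)
Lemma layer_comm n d g h : layer n d g -> layer n d h -> layer n d.+1 [~ g, h].
Proof.
move=> Lg Lh.
have [k [zk zd k0]] := is_subgroup_comm (is_subgroup_layer n d) Lg Lh.
exists k; split=> // w; rewrite leq_eqVlt => /predU1P[sw|]; last exact: zd.
have gh_hg : val (g * h) w = val (h * g) w.
  case: (wordP w) sw => [->//|[i [c [v [c1 ev ->]]]]].
  rewrite rm_cons //= => -[sv].
  have [k1 [gk1 gd _]] := Lg; have [k2 [hk2 hd _]] := Lh.
  rewrite -[LHS]/(val g (val h (rm i c v))) -[RHS]/(val h (val g (rm i c v))).
  by rewrite !(gk1.1, hk2.1) !(gd v, hd v) ?sv // -!int_actD GRing.addrC.
apply: (can_inj (@bij_funK _ (val (h * g)))).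
by rewrite -gh_hg (commgC g h).
Qed.

(** Induction on [n - d]. At [d = n] the exponents vanish beyond the fixed words, so the layer is
    trivial. *)
Lemma folner_layer n d : (d <= n)%N -> folner (layer n d).
Proof.
move=> /subnKC; move: (n - d)%N => e; elim: e d => [|e IH] d nd.
  move=> s m sL; exists unit, (fun=> 1); split=> [|_|x xs]; first by rewrite card_unit.
    by have [] := is_subgroup_layer n d.
  exists id, pred0; split=> //; first by rewrite card0.
  suff -> : x = 1 by rewrite mul1g.
  have [k [xk xd k0]] := sL x xs; apply: val_inj; apply: bijP.
  elim/word_ind => [|i c w c1 ew xw]; first exact: xd.
  have [wd|wd] := ltnP (size w) d; first by apply: xd; rewrite rm_cons.
  by rewrite xk.1 k0 -?nd ?addn0 // int_act0 xw.
apply: (@folner_extension _ _ (layer n d.+1)).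
- exact: is_subgroup_layer.
- exact: is_subgroup_layer.
- by move=> g h; exact: layer_comm.
- exact: layerS.
- by apply: IH; rewrite -nd addnS.
Qed.

Lemma folner_stabilizer : folner [set g : G | val g word0 = word0].
Proof.
move=> s m sH.
suff [n sn] : exists n, forall x, x \in s -> layer n 0 x.
  have [I [f [I0 Hf fs]]] := folner_layer (leq0n n) m sn.
  exists I, f; split=> // i; have [k [_ f0 _]] := Hf i; exact: f0.
elim: s sH => [|x s IH] sH; first by exists 0%N.
have [y ys|n sn] := IH; first by apply: sH; rewrite inE ys orbT.
have [k [l [xk kl]]] := tame_twist_group x.
(* The shortest word of a vertex with nonzero exponent is an initial part of an entry of [l], so
   exponents vanish from this length on. *)
exists (maxn n (\max_(v <- l) size v).+1) => y; rewrite inE => /predU1P[->|/sn].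
  exists k; split=> // [w|i w ew].
    by rewrite leqn0 size_eq0 => /eqP w0; rewrite (_ : w = word0) ?sH ?mem_head //;
      apply: val_inj.
  rewrite geq_max => /andP[_]; apply: contraTeq => /eqP/kl[v vl [c wv]].
  rewrite -leqNgt; apply: (@leq_trans (size v)).
    have <- : rm i c^-1 w = v by rewrite wv rmK.
    by have /size_suffix := rm_suffix c^-1 ew.
  by rewrite big_seq; apply: leq_bigmax_seq.
move=> [k' [yk yd k0]]; exists k'; split=> // i w ew.
by rewrite geq_max => /andP[nw _]; exact: k0.
Qed.

End StabilizerFolner.

(** * The reduced C*-algebra *)

Section Ell2Norm.
Local Open Scope ring_scope.
Local Open Scope complex_scope.
Variables (R : realType) (G : groupType).
Local Notation E := (ell2 R G).
Local Notation normc := Normc.normc.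
Implicit Types (x y : E) (T S : E -> E).

Lemma normc_ge0 (z : R[i]) : 0 <= normc z.
Proof. by case: z => a b; exact: sqrtr_ge0. Qed.

Lemma normc_real (r : R) : normc r%:C = `|r|.
Proof. by rewrite /= expr0n addr0 sqrtr_sqr. Qed.

Lemma sqnormE x : sqnorm x = (ell2_norm x ^+ 2)%:E.
Proof.
have fx : sqnorm x \is a fin_num.
  rewrite ge0_fin_numE ?sqnorm_ge0 //; apply/square_summableP; exact: valP.
by rewrite sqr_sqrtr ?fine_ge0 ?sqnorm_ge0 // fineK.
Qed.

Lemma ell2_norm_ge0 x : 0 <= ell2_norm x. Proof. exact: sqrtr_ge0. Qed.

Lemma ell2_norm_le x r : 0 <= r -> (sqnorm x <= (r ^+ 2)%:E)%E -> ell2_norm x <= r.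
Proof. by move=> r0; rewrite sqnormE lee_fin ler_pXn2r // nnegrE ell2_norm_ge0. Qed.

Lemma ell2_norm_mono x y : (forall g, normc (x g) <= normc (y g)) ->
  ell2_norm x <= ell2_norm y.
Proof.
move=> xy; apply: ell2_norm_le; first exact: ell2_norm_ge0.
rewrite -sqnormE; apply: le_esum => g _; rewrite lee_fin.
by rewrite ler_pXn2r ?nnegrE ?normc_ge0.
Qed.

Lemma normc_le_ell2_norm x g : normc (x g) <= ell2_norm x.
Proof.
rewrite -(ler_pXn2r (isT : (0 < 2)%N)) ?nnegrE ?normc_ge0 ?ell2_norm_ge0 //.
rewrite -lee_fin -sqnormE; apply: esum_ge; exists [set g]; last by rewrite fsbig_set1.
by split=> //; exact: finite_set1.
Qed.

Lemma ell2_norm0_eq x : ell2_norm x = 0 -> x = 0.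
Proof.
move=> x0; apply: val_inj; apply/funext => g /=; apply: Normc.eq0_normc.
by apply/eqP; rewrite eq_le normc_ge0 andbT -x0 normc_le_ell2_norm.
Qed.

Lemma esumZ_le (c : R) (f : G -> R) : 0 <= c -> (forall g, 0 <= f g) ->
  (\esum_(g in [set: G]) (c * f g)%:E <= c%:E * \esum_(g in [set: G]) (f g)%:E)%E.
Proof.
move=> c0 f0; apply: ge_ereal_sup => _ [B [Bfin _] <-].
under eq_fsbigr do rewrite EFinM.
rewrite -ge0_mule_fsumr => [|g]; last by rewrite lee_fin.
by apply: lee_wpmul2l; [rewrite lee_fin|apply: ereal_sup_ubound; exists B].
Qed.

Lemma ell2_normZ_le (c : R[i]) x : ell2_norm (c *: x) <= normc c * ell2_norm x.
Proof.
apply: ell2_norm_le; first by rewrite mulr_ge0 ?normc_ge0 ?ell2_norm_ge0.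
rewrite exprMn EFinM -sqnormE; apply: le_trans (esumZ_le _ _).
- by apply: le_esum => g _; rewrite -exprMn -Normc.normcM.
- exact: sqr_ge0.
- by move=> g; exact: sqr_ge0.
Qed.

Lemma ell2_norm0 : ell2_norm (0 : E) = 0.
Proof.
apply/eqP; rewrite eq_le ell2_norm_ge0 andbT -[X in ell2_norm X](scale0r (0 : E)).
by apply: le_trans (ell2_normZ_le _ _) _; rewrite Normc.normc0 mul0r.
Qed.

Lemma ell2_normD x y : ell2_norm (x + y) <= ell2_norm x + ell2_norm y.
Proof.
have [x0|x0] := eqVneq (ell2_norm x) 0; first by rewrite (ell2_norm0_eq x0) ell2_norm0 !add0r.
have [y0|y0] := eqVneq (ell2_norm y) 0; first by rewrite (ell2_norm0_eq y0) ell2_norm0 !addr0.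
set a := ell2_norm x; set b := ell2_norm y.
have a0 : 0 < a by rewrite lt_def x0 ell2_norm_ge0.
have b0 : 0 < b by rewrite lt_def y0 ell2_norm_ge0.
apply: ell2_norm_le; first by rewrite addr_ge0 // ltW.
have ca : 0 <= (a + b) / a by rewrite divr_ge0 ?addr_ge0 // ltW.
have cb : 0 <= (a + b) / b by rewrite divr_ge0 ?addr_ge0 // ltW.
(* With these weights the termwise estimate sums up to exactly the required bound. *)
have -> : ((a + b) ^+ 2)%:E =
    (((a + b) / a)%:E * sqnorm x + ((a + b) / b)%:E * sqnorm y)%E.
  rewrite !sqnormE -!EFinM -EFinD; congr EFin; rewrite -/a -/b.
  by field; rewrite ?lt0r_neq0.
apply: le_trans (leeD (esumZ_le ca _) (esumZ_le cb _)); try by move=> g; exact: sqr_ge0.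
rewrite -esumD; try by move=> g _; rewrite lee_fin mulr_ge0 ?sqr_ge0.
apply: le_esum => g _; rewrite -EFinD lee_fin.
have -> : (x + y) g = x g + y g by [].
set u := normc (x g); set v := normc (y g).
(* Cauchy-Schwarz: (u + v)^2 <= (a + b) (u^2 / a + v^2 / b) *)
have uv := le_normcD (x g) (y g).
apply: (@le_trans _ _ ((u + v) ^+ 2)).
  by rewrite ler_pXn2r // nnegrE ?addr_ge0 ?normc_ge0.
rewrite -subr_ge0 (_ : _ - _ = (b * u - a * v) ^+ 2 / (a * b)).
  by rewrite divr_ge0 ?sqr_ge0 // ltW // mulr_gt0.
by field; rewrite !lt0r_neq0.
Qed.

Lemma ell2_norm_left_regular g x : ell2_norm (left_regular g x) = ell2_norm x.
Proof.
congr (Num.sqrt (fine _)).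
rewrite /sqnorm [RHS](@reindex_esum _ G G setT setT (fun h => g^-1 * h)%g)//.
split=> // [u v _ _ /= /mulgI//|h _].
by exists (g * h)%g => //; rewrite mulKg.
Qed.

End Ell2Norm.

Section Operators.
Local Open Scope ring_scope.
Local Open Scope complex_scope.
Variables (R : realType) (G : groupType).
Local Notation E := (ell2 R G).
Local Notation normc := Normc.normc.
Implicit Types (x y : E) (T S : E -> E) (X Y Z : set (E -> E)).

(** For linear [T] and nonnegative [M] this is equivalent to [opnorm T <= M], free of suprema and
    extended reals. *)
Definition bounded_by T (M : R) := forall x, ell2_norm (T x) <= M * ell2_norm x.

Lemma bounded_by_opnorm T M : 0 <= M -> bounded_by T M -> (opnorm T <= M%:E)%E.
Proof.
move=> M0 TM; apply: ge_ereal_sup => _ [x /= x1 <-]; rewrite lee_fin.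
by apply: le_trans (TM x) _; rewrite -[leRHS]mulr1 ler_wpM2l.
Qed.

Lemma linear_zero T : linear T -> T 0 = 0.
Proof. by move=> Tl; have := Tl (-1) 0 0; rewrite scaler0 addr0 scaleN1r addNr. Qed.

Lemma linear_scale T (a : R[i]) x : linear T -> T (a *: x) = a *: T x.
Proof. by move=> Tl; rewrite -[a *: x]addr0 Tl linear_zero // addr0. Qed.

Lemma opnorm_bounded_by T M : linear T -> (opnorm T <= M%:E)%E -> bounded_by T M.
Proof.
move=> Tl TM x; have [x0|x0] := eqVneq (ell2_norm x) 0.
  by rewrite (ell2_norm0_eq x0) linear_zero // ell2_norm0 mulr0.
have r0 : 0 < ell2_norm x by rewrite lt_def x0 ell2_norm_ge0.
set r := ell2_norm x in x0 r0 *.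
pose y := (r^-1)%:C *: x.
have y1 : ell2_norm y <= 1.
  apply: le_trans (ell2_normZ_le _ _) _.
  by rewrite normc_real ger0_norm ?invr_ge0 ?(ltW r0) // -/r mulVf.
have Ty : ell2_norm (T y) <= M.
  by rewrite -lee_fin; apply: le_trans TM; apply: ereal_sup_ubound; exists y.
have -> : T x = r%:C *: T y.
  rewrite -linear_scale // /y scalerA -rmorphM mulfV // rmorph1 scale1r //.
apply: le_trans (ell2_normZ_le _ _) _.
by rewrite normc_real ger0_norm ?(ltW r0) // mulrC ler_wpM2r // ltW.
Qed.

Lemma bounded_operatorP T :
  bounded_operator T <-> linear T /\ exists2 M, 0 <= M & bounded_by T M.
Proof.
split=> [[Tl]|[Tl [M M0 TM]]].
  have : (0 <= opnorm T)%E.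
    apply: ereal_sup_ubound; exists 0; first by rewrite /= ell2_norm0.
    by rewrite linear_zero // ell2_norm0.
  case e: (opnorm T) => [M| |] //= M0 _; split=> //; exists M => //.
  by apply: opnorm_bounded_by => //; rewrite e.
split=> //; apply: le_lt_trans (bounded_by_opnorm M0 TM) _; exact: ltry.
Qed.

Lemma linear_sub T S : linear T -> linear S -> linear (T - S).
Proof.
move=> Tl Sl a x y; rewrite -[LHS]/(T (a *: x + y) - S (a *: x + y)) Tl Sl.
by rewrite -[(T - S) x]/(T x - S x) -[(T - S) y]/(T y - S y) scalerBr opprD addrACA.
Qed.

Lemma opnorm_closureP X T : X `<=` @bounded_operator R G ->
  opnorm_closure X T <-> bounded_operator T /\
    forall e : R, 0 < e -> exists2 S, X S & bounded_by (T - S) e.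
Proof.
move=> Xb; split=> -[Tb TX]; split=> // e e0.
  have [S XS Se] := TX e e0; exists S => //; apply: opnorm_bounded_by (ltW Se).
  by apply: linear_sub; [have [] := Tb|have [] := Xb S XS].
(* Halving [e] recovers the strict inequality. *)
have [S XS Se] := TX (e / 2) (divr_gt0 e0 (ltr0n _ 2)); exists S => //.
apply: le_lt_trans (bounded_by_opnorm _ Se) _; first by rewrite ltW // divr_gt0.
by rewrite lte_fin ltr_pdivrMr // ltr_pMr // ltr1n.
Qed.

End Operators.

Section OperatorClosure.
Local Open Scope ring_scope.
Local Open Scope complex_scope.
Variables (R : realType) (G : groupType).
Local Notation E := (ell2 R G).
Local Notation normc := Normc.normc.
Local Notation bop := (@bounded_operator R G).
Implicit Types (x y : E) (T S U : E -> E) (X Y Z : set (E -> E)).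

Lemma mul_div_succ_le (r e : R) : 0 <= r -> 0 <= e -> r * (e / (r + 1)) <= e.
Proof.
by move=> r0 e0; rewrite mulrA ler_pdivrMr ?ltr_wpDl // mulrC ler_wpM2l ?lerDl.
Qed.

Lemma bounded_byD S T U (M N : R) : (forall x, U x = S x + T x) ->
  bounded_by S M -> bounded_by T N -> bounded_by U (M + N).
Proof.
move=> UE SM TN x; rewrite UE; apply: le_trans (ell2_normD (S x) (T x)) _.
by rewrite mulrDl lerD.
Qed.

Lemma bounded_byZ (a : R[i]) S U (M : R) : (forall x, U x = a *: S x) ->
  bounded_by S M -> bounded_by U (normc a * M).
Proof.
move=> UE SM x; rewrite UE; apply: le_trans (ell2_normZ_le a (S x)) _.
by rewrite -mulrA ler_wpM2l ?normc_ge0.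
Qed.

Lemma bounded_by_comp S T (M N : R) : 0 <= M ->
  bounded_by S M -> bounded_by T N -> bounded_by (S \o T) (M * N).
Proof.
move=> M0 SM TN x; apply: le_trans (SM (T x)) _.
by rewrite -mulrA ler_wpM2l.
Qed.

Lemma bounded_by_le S (M N : R) : M <= N -> bounded_by S M -> bounded_by S N.
Proof. by move=> MN SM x; apply: le_trans (SM x) _; rewrite ler_wpM2r ?ell2_norm_ge0. Qed.

Lemma linear_lin (a : R[i]) S T : linear S -> linear T -> linear (a *: S + T).
Proof.
move=> Sl Tl b x y.
rewrite -[LHS]/(a *: S (b *: x + y) + T (b *: x + y)) Sl Tl.
rewrite -[(a *: S + T) x]/(a *: S x + T x) -[(a *: S + T) y]/(a *: S y + T y).
by rewrite !scalerDr !scalerA [b * a]mulrC addrACA.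
Qed.

Lemma linear_comp S T : linear S -> linear T -> linear (S \o T).
Proof. by move=> Sl Tl b x y; rewrite /= Tl Sl. Qed.

Lemma bounded_operator_lin (a : R[i]) S T : bop S -> bop T -> bop (a *: S + T).
Proof.
move=> /bounded_operatorP[Sl [M M0 SM]] /bounded_operatorP[Tl [N N0 TN]].
apply/bounded_operatorP; split; first exact: linear_lin.
exists (normc a * M + N); first by rewrite addr_ge0 ?mulr_ge0 ?normc_ge0.
apply: (bounded_byD (S := a *: S)) TN => //; exact: bounded_byZ SM.
Qed.

Lemma bounded_operator_comp S T : bop S -> bop T -> bop (S \o T).
Proof.
move=> /bounded_operatorP[Sl [M M0 SM]] /bounded_operatorP[Tl [N N0 TN]].
apply/bounded_operatorP; split; first exact: linear_comp.
by exists (M * N); [exact: mulr_ge0|exact: bounded_by_comp].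
Qed.

Lemma opnorm_closure_sub X : X `<=` bop -> X `<=` opnorm_closure X.
Proof.
move=> Xb T XT; apply/opnorm_closureP => //; split; first exact: Xb.
move=> e e0; exists T => // x; rewrite subrr -[X in ell2_norm X]/(0 : E).
by rewrite ell2_norm0 mulr_ge0 ?ell2_norm_ge0 // ltW.
Qed.

Lemma opnorm_closure_bounded X : opnorm_closure X `<=` bop.
Proof. by move=> T []. Qed.

Lemma opnorm_closure_mono X Y : X `<=` Y -> opnorm_closure X `<=` opnorm_closure Y.
Proof. by move=> XY T [Tb TX]; split=> // e /TX[S /XY YS Se]; exists S. Qed.

Lemma opnorm_closure_lin X (a : R[i]) S T : X `<=` bop ->
  (forall S T, X S -> X T -> X (a *: S + T)) ->
  opnorm_closure X S -> opnorm_closure X T -> opnorm_closure X (a *: S + T).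
Proof.
move=> Xb Xlin /(opnorm_closureP _ Xb)[Sb SX] /(opnorm_closureP _ Xb)[Tb TX].
apply/opnorm_closureP => //; split; first exact: bounded_operator_lin.
move=> e e0; have a1 : 0 < normc a + 1 by rewrite ltr_wpDl ?normc_ge0.
have e2 : 0 < e / 2 / (normc a + 1) by rewrite !divr_gt0.
have [S' XS' SS'] := SX _ e2; have [T' XT' TT'] := TX _ (divr_gt0 e0 (ltr0n _ 2)).
exists (a *: S' + T'); first exact: Xlin.
have eE : normc a * (e / 2 / (normc a + 1)) + e / 2 <= e.
  by rewrite [leRHS]splitr lerD2r mul_div_succ_le ?normc_ge0 // divr_ge0 ?ltW.
apply: bounded_by_le eE _.
apply: (bounded_byD (S := fun x => a *: (S x - S' x))) TT' => [x|]; last exact: bounded_byZ SS'.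
rewrite -[LHS]/((a *: S x + T x) - (a *: S' x + T' x)).
by rewrite scalerBr opprD addrACA.
Qed.

(** Uses [S T - S' T' = S (T - T') + (S - S') T']. The approximant [T'] is chosen first, since the
    accuracy asked of [S'] depends on a bound for [T']. *)
Lemma opnorm_closure_comp X Y Z S T : X `<=` bop -> Y `<=` bop -> Z `<=` bop ->
  (forall S T, X S -> Y T -> Z (S \o T)) ->
  opnorm_closure X S -> opnorm_closure Y T -> opnorm_closure Z (S \o T).
Proof.
move=> Xb Yb Zb XYZ /(opnorm_closureP _ Xb)[Sb SX] /(opnorm_closureP _ Yb)[Tb TX].
apply/opnorm_closureP => //; split; first exact: bounded_operator_comp.
move=> e e0; have /bounded_operatorP[Sl [M M0 SM]] := Sb.
have M1 : 0 < M + 1 by rewrite ltr_wpDl.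
have [T' YT' TT'] := TX (e / 2 / (M + 1)) ltac:(by rewrite !divr_gt0).
have /bounded_operatorP[T'l [N N0 TN]] := Yb _ YT'.
have N1 : 0 < N + 1 by rewrite ltr_wpDl.
have [S' XS' SS'] := SX (e / 2 / (N + 1)) ltac:(by rewrite !divr_gt0).
exists (S' \o T'); first exact: XYZ.
have UE x : ((S \o T) - (S' \o T')) x = (S \o (T - T')) x + ((S - S') \o T') x.
  rewrite -[LHS]/(S (T x) - S' (T' x)).
  rewrite -[RHS]/(S (T x - T' x) + (S (T' x) - S' (T' x))).
  have -> : S (T x - T' x) = S (T x) - S (T' x).
    by rewrite -scaleN1r addrC Sl scaleN1r addrC.
  by rewrite addrA subrK.
apply: bounded_by_le (bounded_byD UE (bounded_by_comp M0 SM TT') (bounded_by_comp _ SS' TN)).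
  by rewrite [leRHS]splitr lerD ?[_ * N]mulrC ?mul_div_succ_le // divr_ge0 ?ltW.
by rewrite ltW // !divr_gt0.
Qed.

Lemma opnorm_closure_idem X : X `<=` bop ->
  opnorm_closure (opnorm_closure X) `<=` opnorm_closure X.
Proof.
move=> Xb T /(opnorm_closureP _ (@opnorm_closure_bounded X))[Tb TX].
apply/opnorm_closureP => //; split=> // e e0.
have [S /(opnorm_closureP _ Xb)[_ SX] TS] := TX _ (divr_gt0 e0 (ltr0n _ 2)).
have [S' XS' SS'] := SX _ (divr_gt0 e0 (ltr0n _ 2)); exists S' => //.
have UE x : (T - S') x = (T - S) x + (S - S') x.
  by rewrite -[LHS]/(T x - S' x) -[RHS]/(T x - S x + (S x - S' x)) addrA subrK.
by apply: bounded_by_le (bounded_byD UE TS SS'); rewrite -splitr.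
Qed.

End OperatorClosure.

(** * Failure of C*-simplicity *)

Section FormalSums.
Local Open Scope ring_scope.
Local Open Scope complex_scope.
Variables (R : realType) (G : groupType).
Local Notation E := (ell2 R G).
Local Notation bop := (@bounded_operator R G).
Implicit Types (x y : E) (T S : E -> E) (l : seq (R[i] * G)).

(** Repeated group elements are allowed in [l], so that sums are concatenations and products are
    lists of pairs. *)
Definition formal_op l : E -> E := \sum_(p <- l) p.1 *: left_regular p.2.

Lemma formal_opE l x : formal_op l x = \sum_(p <- l) p.1 *: left_regular p.2 x.
Proof. by rewrite /formal_op fct_sumE. Qed.

Lemma formal_op_cons p l : formal_op (p :: l) = p.1 *: left_regular p.2 + formal_op l.
Proof. by rewrite /formal_op big_cons. Qed.

Lemma left_regular_linear (g : G) : linear (@left_regular R G g).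
Proof. by move=> a x y; apply: val_inj. Qed.

Lemma left_regularM (g h : G) x : left_regular (g * h)%g x = left_regular g (left_regular h x).
Proof. by apply: val_inj; apply/funext => k /=; rewrite invgM mulgA. Qed.

Lemma left_regular_bounded (g : G) : bop (@left_regular R G g).
Proof.
apply/bounded_operatorP; split; first exact: left_regular_linear.
by exists 1 => // x; rewrite mul1r ell2_norm_left_regular.
Qed.

Lemma bounded_operator0 : bop 0.
Proof.
apply/bounded_operatorP; split=> [a x y|]; first by rewrite /= scaler0 addr0.
by exists 0 => // x; rewrite mul0r -[X in ell2_norm X]/(0 : E) ell2_norm0.
Qed.

Lemma formal_op_bounded l : bop (formal_op l).
Proof.
elim: l => [|p l IH]; first by rewrite /formal_op big_nil; exact: bounded_operator0.
by rewrite formal_op_cons; apply: bounded_operator_lin => //; exact: left_regular_bounded.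
Qed.

Lemma linear_sum T (I : Type) (r : seq I) (F : I -> E) : linear T ->
  T (\sum_(i <- r) F i) = \sum_(i <- r) T (F i).
Proof.
move=> Tl; elim: r => [|i r IH]; first by rewrite !big_nil linear_zero.
by rewrite !big_cons -IH -[F i in LHS]scale1r Tl scale1r.
Qed.

Lemma formal_op_comp l l' : formal_op l \o formal_op l' =
  formal_op [seq (p.1 * q.1, (p.2 * q.2)%g) | p <- l, q <- l'].
Proof.
apply/funext => x; rewrite /= !formal_opE big_allpairs_dep /=.
apply: eq_bigr => p _; rewrite linear_sum; last exact: left_regular_linear.
rewrite scaler_sumr; apply: eq_bigr => q _.
by rewrite linear_scale ?scalerA ?left_regularM //; exact: left_regular_linear.
Qed.

Lemma group_algebraP T : group_algebra T <-> exists l, T = formal_op l.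
Proof.
split=> [[s [c ->]]|[l ->]].
  by exists [seq (c g, g) | g <- s]; rewrite /formal_op big_map.
(* Without repetitions in [s], changing [c] at [h] affects a single term. *)
suff [s [c [_ ->]]] : exists (s : seq G) (c : G -> R[i]),
    uniq s /\ formal_op l = \sum_(g <- s) c g *: left_regular g by exists s, c.
elim: l => [|[a h] l [s [c [us El]]]].
  by exists [::], (fun=> 0); rewrite /formal_op !big_nil.
rewrite formal_op_cons {}El /=.
have [hs|hs] := boolP (h \in s); last first.
  exists (h :: s), (fun g => if g == h then a else c g); split; first by rewrite /= hs.
  rewrite big_cons eqxx; congr (_ + _); apply: eq_big_seq => g gs.
  by case: eqP => // gh; move: hs; rewrite -gh gs.
exists s, (fun g => if g == h then a + c h else c g); split=> //.
rewrite [X in _ + X = _](bigD1_seq h) // [RHS](bigD1_seq h) //= eqxx scalerDl addrA.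
by congr (_ + _); apply: eq_bigr => g /negPf ->.
Qed.

End FormalSums.

Section NotSimple.
Local Open Scope ring_scope.
Local Open Scope complex_scope.
Variables (R : realType) (G : groupType) (H : set G).
Local Notation E := (ell2 R G).
Local Notation normc := Normc.normc.
Local Notation bop := (@bounded_operator R G).
Implicit Types (x y : E) (T S : E -> E) (l : seq (R[i] * G)).

(* [formal_op l] acts trivially on ell^2(G/H): this is the vanishing of its
   matrix coefficient between the cosets [u^-1 H] and [v H]. *)
Definition coset_null l := forall u v : G,
  \sum_(p <- l | `[< H (u * p.2 * v)%g >]) p.1 = 0.

Definition coset_kernel : set (E -> E) := [set formal_op l | l in coset_null].

Lemma coset_kernel_bounded : coset_kernel `<=` bop.
Proof. by move=> _ [l _ <-]; exact: formal_op_bounded. Qed.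

Lemma group_algebra_bounded : @group_algebra R G `<=` bop.
Proof. by move=> T /group_algebraP[l ->]; exact: formal_op_bounded. Qed.

Lemma coset_kernel_lin (a : R[i]) S T :
  coset_kernel S -> coset_kernel T -> coset_kernel (a *: S + T).
Proof.
move=> [l nl <-] [l' nl' <-]; exists ([seq (a * p.1, p.2) | p <- l] ++ l').
  move=> u v; rewrite big_cat /= big_map /= nl' addr0.
  by rewrite -mulr_sumr nl mulr0.
apply/funext => x; rewrite -[RHS]/(a *: formal_op l x + formal_op l' x).
rewrite !formal_opE big_cat big_map /=; congr (_ + _).
by rewrite scaler_sumr; apply: eq_bigr => p _; rewrite scalerA.
Qed.

Lemma coset_kernel_comp_l S T : group_algebra S -> coset_kernel T -> coset_kernel (S \o T).
Proof.
move=> /group_algebraP[l ->] [l' nl' <-]; rewrite formal_op_comp; eexists; last by [].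
move=> u v; rewrite big_mkcond big_allpairs_dep /= big1 // => p _.
rewrite -big_mkcond /= -mulr_sumr.
suff -> : \sum_(q <- l' | `[< H (u * (p.2 * q.2) * v)%g >]) q.1 = 0 by rewrite mulr0.
by apply: etrans (nl' (u * p.2)%g v); apply: eq_bigl => q; rewrite !mulgA.
Qed.

Lemma coset_kernel_comp_r S T : coset_kernel S -> group_algebra T -> coset_kernel (S \o T).
Proof.
move=> [l nl <-] /group_algebraP[l' ->]; rewrite formal_op_comp; eexists; last by [].
move=> u v; rewrite big_mkcond big_allpairs_dep /= exchange_big /= big1 // => q _.
rewrite -big_mkcond /= -mulr_suml.
suff -> : \sum_(p <- l | `[< H (u * (p.2 * q.2) * v)%g >]) p.1 = 0 by rewrite mul0r.
by apply: etrans (nl u (q.2 * v)%g); apply: eq_bigl => p; rewrite !mulgA.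
Qed.

Lemma coset_kernel_group_algebra : coset_kernel `<=` @group_algebra R G.
Proof. by move=> _ [l _ <-]; apply/group_algebraP; exists l. Qed.

(** The kernel is a two-sided ideal of the group algebra, and continuity of sums and products passes
    this to the closures. *)
Lemma coset_ideal : closed_two_sided_ideal (opnorm_closure coset_kernel).
Proof.
have kb := coset_kernel_bounded; have gb := group_algebra_bounded.
split.
- exact: opnorm_closure_mono coset_kernel_group_algebra.
- split=> [|a S T]; last by apply: opnorm_closure_lin => // S' T'; exact: coset_kernel_lin.
  apply: opnorm_closure_sub => //; exists [::]; last by rewrite /formal_op big_nil.
  by move=> u v; rewrite big_nil.
- by move=> S T; apply: opnorm_closure_comp => //; exact: coset_kernel_comp_l.
- move=> S T AS IT; apply: (opnorm_closure_comp _ _ _ _ IT AS) => //.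
  exact: coset_kernel_comp_r.
- exact: opnorm_closure_idem.
Qed.

End NotSimple.

(** * Almost invariant vectors *)

Section TestVector.
Local Open Scope ring_scope.
Local Open Scope complex_scope.
Variables (R : realType) (G : groupType) (H : set G).
Local Notation E := (ell2 R G).
Local Notation normc := Normc.normc.
Implicit Types (x y : E).

Lemma esum_delta (h : G) (c : R) : 0 <= c ->
  \esum_(g in [set: G]) ((h == g)%:R * c)%:E = c%:E.
Proof.
move=> c0; rewrite -[RHS](@esum_set1 R G h (fun=> c%:E)) ?lee_fin // [RHS]esum_mkcond.
apply: eq_esum => g _; rewrite [g \in _](_ : _ = (h == g)); last first.
  by apply/idP/eqP => [|<-]; rewrite inE.
by case: eqP; rewrite ?mul1r ?mul0r.
Qed.

(** Turns almost invariance of a density in the l^1 norm into almost invariance of its square root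
    in the l^2 norm. *)
Lemma sqr_sqrtB_le (a b : R) : 0 <= a -> 0 <= b ->
  (Num.sqrt a - Num.sqrt b) ^+ 2 <= `|a - b|.
Proof.
move=> a0 b0; wlog ab : a b a0 b0 / b <= a => [hw|].
  have [/hw->//|/ltW/hw] := leP b a.
  by rewrite -[X in X ^+ 2]opprB sqrrN distrC; apply.
rewrite ger0_norm ?subr_ge0 // -{2}(sqr_sqrtr a0) -{2}(sqr_sqrtr b0).
have := ler_wsqrtr ab; have := sqrtr_ge0 b; set u := Num.sqrt a; set v := Num.sqrt b.
move=> v0 vu; rewrite -subr_ge0 (_ : _ - _ = 2 * v * (u - v)); last by ring.
by rewrite !mulr_ge0 ?subr_ge0.
Qed.

(** The vector is the square root of [p], the distribution of [f] under the uniform measure on [I].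
    After reindexing by [t] the indices outside [D] cancel, which leaves at most [2 #|D| / #|I|]. *)
Lemma folner_vector (s : seq G) (m : nat) : folner H -> (0 < m)%N ->
  (forall g, g \in s -> H g) ->
  exists xi : E, [/\ ell2_norm xi = 1, forall g, ~ H g -> xi g = 0 &
    forall g, g \in s -> ell2_norm (left_regular g xi - xi) ^+ 2 <= 2 / m%:R].
Proof.
move=> fH m0 sH; have [I [f [I0 Hf fs]]] := fH s m sH.
pose N : R := #|I|%:R; have N0 : 0 < N by rewrite ltr0n.
have NV0 : 0 <= N^-1 by rewrite invr_ge0 ltW.
pose p g : R := \sum_i (f i == g)%:R * N^-1.
have p0 g : 0 <= p g by apply: sumr_ge0 => i _; rewrite mulr_ge0.
have esum_nat (J : finType) (D : pred J) (F : J -> G) (c : R) : 0 <= c ->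
    \esum_(g in [set: G]) (\sum_(j | D j) (F j == g)%:R * c)%:E = (#|D|%:R * c)%:E.
  move=> c0; under eq_esum do rewrite -sumEFin.
  rewrite esum_sum; last by move=> g j _ _; rewrite lee_fin mulr_ge0.
  under eq_bigr do rewrite esum_delta //.
  by rewrite sumEFin sumr_const mulr_natl.
have normp g : normc (Num.sqrt (p g))%:C ^+ 2 = p g.
  by rewrite normc_real ger0_norm ?sqrtr_ge0 // sqr_sqrtr.
have sp : sqnorm (fun g => (Num.sqrt (p g))%:C) = 1%:E.
  rewrite /sqnorm; under eq_esum do rewrite normp.
  rewrite (esum_nat I predT f) //; congr EFin.
  by rewrite -/N mulfV // gt_eqF.
have ss : (fun g => (Num.sqrt (p g))%:C) \in @square_summable R G.
  by apply/square_summableP; rewrite sp ltry.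
exists (Ell2 ss); split=> [|g Hg|x xs].
- by rewrite /ell2_norm sp sqrtr1.
- rewrite /= (_ : p g = 0) ?sqrtr0 // /p big1 // => i _.
  by case: eqP => [fg|]; [case: Hg; rewrite -fg|rewrite mul0r].
have [t [D [tinj cD ft]]] := fs x xs.
rewrite -lee_fin -sqnormE.
apply: (@le_trans _ _ (\esum_(g in [set: G])
   ((\sum_(i | D i) (x * f i == g)%g%:R * N^-1) +
    (\sum_(i | D i) (f (t i) == g)%:R * N^-1))%:E)); last first.
  under eq_esum do rewrite EFinD.
  rewrite esumD; try by move=> g _; rewrite lee_fin sumr_ge0 // => i _; rewrite mulr_ge0.
  rewrite (esum_nat I D (fun i => x * f i)%g) // (esum_nat I D (f \o t)) //.
  rewrite -EFinD lee_fin ler_pdivlMr ?ltr0n //.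
  rewrite (_ : _ * _ = 2 * ((#|D|%:R * m%:R) / N)); last by ring.
  by rewrite ger_pMr // ler_pdivrMr // mul1r -natrM ler_nat.
apply: le_esum => g _; rewrite lee_fin.
have -> : (left_regular x (Ell2 ss) - Ell2 ss) g =
    (Num.sqrt (p (x^-1 * g)%g) - Num.sqrt (p g))%:C.
  by rewrite rmorphB.
rewrite normc_real -normrX ger0_norm ?sqr_ge0 //.
apply: le_trans (sqr_sqrtB_le (p0 _) (p0 _)) _.
have -> : p (x^-1 * g)%g = \sum_i (x * f i == g)%g%:R * N^-1.
  by apply: eq_bigr => i _; rewrite -(inj_eq (mulgI x)) mulVKg.
have -> : p g = \sum_i (f (t i) == g)%:R * N^-1 by rewrite /p (reindex_inj tinj).
rewrite -sumrB.
rewrite (bigID D) /= [X in `|_ + X|]big1 => [|i /ft ->]; last by rewrite subrr.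
rewrite addr0 -big_split /=; apply: le_trans (ler_norm_sum _ _ _) _.
apply: ler_sum => i _; apply: le_trans (ler_normB _ _) _.
by rewrite !ger0_norm // mulr_ge0.
Qed.

End TestVector.

Section NotSimpleCriterion.
Local Open Scope ring_scope.
Local Open Scope complex_scope.
Variables (R : realType) (G : groupType) (H : set G).
Local Notation E := (ell2 R G).
Local Notation normc := Normc.normc.
Implicit Types (x y : E).

Lemma restrict_square_summable x :
  (fun g => if `[< H g >] then x g else 0) \in @square_summable R G.
Proof.
case: x => x /= /square_summableP xfin; apply/square_summableP.
apply: le_lt_trans xfin; apply: le_esum => g _; rewrite lee_fin.
by case: ifP => // _; rewrite Normc.normc0 expr0n sqr_ge0.
Qed.

Definition restrict x : E := Ell2 (restrict_square_summable x).

Lemma ell2_norm_restrict x : ell2_norm (restrict x) <= ell2_norm x.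
Proof.
apply: ell2_norm_mono => g /=; case: ifP => // _.
by rewrite Normc.normc0 normc_ge0.
Qed.

Lemma restrict_linear : linear restrict.
Proof.
move=> a x y; apply: val_inj; apply/funext => g /=; case: ifP => gH;
  rewrite -[RHS]/(a * restrict x g + restrict y g) /= gH //.
by rewrite mulr0 addr0.
Qed.

Hypothesis H_sub : is_subgroup H.

(** Restriction to [H] kills the translates of [xi] by elements outside [H]. The coefficients over
    [H] sum to zero, so almost invariance makes the remaining part of [formal_op l xi] small. An
    element of the kernel within 1/2 of the identity would then give [1 <= 1/2 + 1/4]. *)
Lemma identity_not_in_coset_ideal : folner H ->
  ~ opnorm_closure (@coset_kernel R G H) (id : E -> E).
Proof.
move=> fH /(opnorm_closureP _ (@coset_kernel_bounded R G H))[_].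
move=> /(_ (2^-1) _)[|_ [l nl <-] lb]; first by rewrite invr_gt0.
pose C := \sum_(p <- l) normc p.1.
have C0 : 0 <= C by apply: sumr_ge0 => p _; exact: normc_ge0.
(* Chosen so that the total error [C * d] is at most 1/4. *)
pose d := (4 * (C + 1))^-1; have d0 : 0 < d by rewrite invr_gt0 mulr_gt0 // ltr_wpDl.
have [m m0 md] : exists2 m : nat, (0 < m)%N & 2 / m%:R <= d ^+ 2.
  exists (Num.Def.truncn (2 / d ^+ 2)).+1 => //.
  rewrite ler_pdivrMr ?ltr0n // mulrC -ler_pdivrMr ?exprn_gt0 // ltW //.
  by rewrite truncnS_gt // divr_ge0 // exprn_ge0 // ltW.
have [|xi [xi1 xiH xis]] :=
    @folner_vector R G H [seq p.2 | p <- l & `[< H p.2 >]] m fH m0.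
  by move=> g /mapP[p]; rewrite mem_filter => /andP[/asboolP Hp _] ->.
have [H1 HM HV] := H_sub.
have RH g : H g -> restrict (left_regular g xi) = left_regular g xi.
  move=> Hg; apply: val_inj; apply/funext => h /=; case: asboolP => // Hh.
  by rewrite xiH // => /(HM _ _ Hg); rewrite mulVKg.
have RnH g : ~ H g -> restrict (left_regular g xi) = 0.
  move=> Hg; apply: val_inj; apply/funext => h /=; case: asboolP => // Hh.
  rewrite xiH // => /HV; rewrite invgM invgK => Hgh; apply: Hg.
  by have := HM _ _ Hh Hgh; rewrite mulVKg.
have Rxi : restrict (xi - formal_op l xi) =
    xi - \sum_(p <- l | `[< H p.2 >]) p.1 *: (left_regular p.2 xi - xi).
  have Rsub x y : restrict (x - y) = restrict x - restrict y.
    by rewrite addrC -scaleN1r restrict_linear scaleN1r addrC.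
  rewrite Rsub formal_opE (linear_sum _ _ restrict_linear); congr (_ - _).
    apply: val_inj; apply/funext => h /=; case: asboolP => // Hh.
    by rewrite xiH.
  rewrite [RHS]big_mkcond /=.
  transitivity (\sum_(p <- l) (if `[< H p.2 >] then p.1 *: left_regular p.2 xi else 0)).
    apply: eq_bigr => p _; rewrite linear_scale; last exact: restrict_linear.
    by case: asboolP => Hp; [rewrite RH|rewrite RnH // scaler0].
  rewrite -!big_mkcond /=; under [RHS]eq_bigr do rewrite scalerBr.
  rewrite sumrB -scaler_suml.
  have -> : \sum_(p <- l | `[< H p.2 >]) p.1 = 0.
    by apply: etrans (nl 1%g 1%g); apply: eq_bigl => p; rewrite mul1g mulg1.
  by rewrite scale0r subr0.
have le1 : ell2_norm (restrict (xi - formal_op l xi)) <= 2^-1.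
  by apply: le_trans (ell2_norm_restrict _) _; have := lb xi; rewrite xi1 mulr1.
have le2 : ell2_norm (\sum_(p <- l | `[< H p.2 >]) p.1 *: (left_regular p.2 xi - xi)) <= C * d.
  rewrite /C mulr_suml big_mkcond big_seq [leRHS]big_seq /=.
  elim/big_ind2: _ => [|x r y r' xr yr|p pl]; first by rewrite ell2_norm0.
    exact: le_trans (ell2_normD _ _) (lerD xr yr).
  case: asboolP => Hp; last by rewrite ell2_norm0 mulr_ge0 ?normc_ge0 ?ltW.
  apply: le_trans (ell2_normZ_le _ _) _; rewrite ler_wpM2l ?normc_ge0 //.
  rewrite -(ler_pXn2r (isT : (0 < 2)%N)) ?nnegrE ?ell2_norm_ge0 ?(ltW d0) //.
  apply: le_trans md; apply: xis; apply/mapP; exists p => //.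
  by rewrite mem_filter pl andbT; apply/asboolP.
have Cd : C * d <= 4^-1.
  rewrite /d invfM mulrCA ger_pMr ?invr_gt0 // ler_pdivrMr ?ltr_wpDl // mul1r.
  by rewrite lerDl.
have : ell2_norm xi <= 2^-1 + C * d.
  rewrite -[xi in leLHS](subrK (\sum_(p <- l | `[< H p.2 >]) p.1 *: (left_regular p.2 xi - xi))).
  by apply: le_trans (ell2_normD _ _) _; rewrite -Rxi; exact: lerD.
rewrite xi1; lra.
Qed.

(** The witness is [(1 - a)(1 - b)]. For each coset [v H], either [b] fixes it or [a] fixes both
    [v H] and [b v H]; in both cases the four terms cancel. The coefficient at the identity is 1 or
    2, so the operator is not zero. *)
Lemma not_Cstar_simple_of_disjoint_supports (a b : G) : folner H ->
  a <> 1%g -> b <> 1%g ->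
  (forall v, H (b ^ v)%g \/ (H (a ^ v)%g /\ H (a ^ (b * v))%g)) ->
  ~ Cstar_simple R G.
Proof.
move=> fH a1 b1 ab simple; have [H1 HM HV] := H_sub.
pose l : seq (R[i] * G) := [:: (1, 1%g); (-1, a); (-1, b); (1, (a * b)%g)].
have nl : coset_null H l.
  move=> u v; rewrite /l !big_cons big_nil /= mulg1 addr0.
  (* The condition [H (g ^ v)] says that [g] fixes the coset [v H]. *)
  have HE g : H (g ^ v)%g -> `[< H (u * g * v)%g >] = `[< H (u * v)%g >].
    move=> Hg; apply: asbool_equiv_eq.
    have -> : (u * g * v = u * v * g ^ v)%g by rewrite conjgE !mulgA mulgK.
    split=> [h|h]; last exact: HM.
    by have := HM _ _ h (HV _ Hg); rewrite mulgK.
  have [Hb|[Ha Hab]] := ab v.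
    rewrite (HE b) // (_ : u * (a * b) * v = u * a * v * b ^ v)%g; last first.
      by rewrite conjgE !mulgA mulgK.
    have -> : `[< H (u * a * v * b ^ v)%g >] = `[< H (u * a * v)%g >].
      apply: asbool_equiv_eq; split=> [h|h]; last exact: HM.
      by have := HM _ _ h (HV _ Hb); rewrite mulgK.
    by case: asboolP => _; case: asboolP => _; ring.
  rewrite (HE a) // (_ : u * (a * b) * v = u * b * v * a ^ (b * v))%g; last first.
    by rewrite conjgE invgM !mulgA !mulgK.
  have -> : `[< H (u * b * v * a ^ (b * v))%g >] = `[< H (u * b * v)%g >].
    apply: asbool_equiv_eq; split=> [h|h]; last exact: HM.
    by have := HM _ _ h (HV _ Hab); rewrite mulgK.
  by case: asboolP => _; case: asboolP => _; ring.
have kl : @coset_kernel R G H (formal_op l) by exists l.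
have [I0|Iall] := simple _ (coset_ideal R H).
  have : opnorm_closure (@coset_kernel R G H) (formal_op l).
    by apply: opnorm_closure_sub => //; exact: coset_kernel_bounded.
  rewrite I0 => /= l0.
  (* The delta function at the identity reads off the coefficient there. *)
  have ds : (fun g : G => (g == 1%g)%:R : R[i]) \in @square_summable R G.
    apply/square_summableP; rewrite /sqnorm.
    rewrite (_ : \esum_(g in _) _ = 1%:E) ?ltry // -[RHS](esum_delta (1%g : G) (@ler01 R)).
    apply: eq_esum => g _; rewrite eq_sym mulr1; case: eqP => _.
      by rewrite Normc.normc1 expr1n.
    by rewrite Normc.normc0 expr0n.
  have := congr1 (fun T : E -> E => T (Ell2 ds) 1%g) l0.
  rewrite /= formal_opE /l !big_cons big_nil /=.
  rewrite -[LHS]/(1 * (1^-1 * 1 == 1)%g%:R + (-1 * (a^-1 * 1 == 1)%g%:R +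
    (-1 * (b^-1 * 1 == 1)%g%:R + (1 * ((a * b)^-1 * 1 == 1)%g%:R + 0)))).
  rewrite !mulg1 invg1 eqxx !invg_eq1 (introF eqP a1) (introF eqP b1).
  rewrite -[RHS]/(0 : R[i]) !mulr0 !add0r mul1r addr0 mul1r => /eqP.
  by rewrite -natrD pnatr_eq0.
apply: (identity_not_in_coset_ideal fH); rewrite Iall.
apply: opnorm_closure_sub; first exact: group_algebra_bounded.
apply/group_algebraP; exists [:: (1, 1%g)]; apply/funext => x.
rewrite formal_opE big_cons big_nil /= addr0 scale1r; apply: val_inj.
by apply/funext => g /=; rewrite invg1 mul1g.
Qed.

End NotSimpleCriterion.

(** * The embedding *)

Section TwistGroupProperties.
Variables (A : groupType) (th : int_action A).
Hypothesis th_faithful : forall n, (forall c, th n c = c) -> n = 0%R.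
Local Notation G := (twist_group th).

Lemma twist_fix (w : word A) : ~~ starts false w -> twist th w = w.
Proof.
have tw := cocycle_twist th; elim/word_ind: w => // i c w c1 ew IH.
rewrite tw.1 rm_cons //; case: ifPn => [/[dup] rw /rootcosetP[ei _]|_]; last first.
  rewrite int_act0; case: w ew IH => -[|x w] rw ew IH; last by move=> /IH ->.
  by rewrite (_ : Word rw = word0) //; apply: val_inj.
subst i; move: rw; rewrite /rootcoset /=.
by case: (wseq w) => [|[[] d] [|]].
Qed.

(** The word [c^-1 w] starts in the factor [true], where the twist does nothing. *)
Lemma lmul_twist_fix c (w : word A) : c != 1 -> starts false w ->
  lmul th true c (twist th (lmul th true c^-1 w)) = w.
Proof.
move=> c1 sw; rewrite twist_fix; last first.
  have [j sj|z [-> _ _]] := cocycle_cat (w := word0) (cocycle_lmul th true c^-1) (esym (cats0 w)).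
    have -> : j = false by move: sj sw; rewrite /starts; case: (wseq w) => // x s /eqP <- /eqP.
    by rewrite lmul0 rm_cons ?invg_eq1.
  rewrite lmul0 rm_cons ?invg_eq1 //; rewrite /starts.
  by case: z => [|y z] //=; rewrite last_cat.
by rewrite -[lmul th true c^-1 w]/(bij_inv (lmul th true c) w) bij_invK.
Qed.

Lemma not_Cstar_simple_twist_group (R : realType) : ~ Cstar_simple R G.
Proof.
have [c c1] : exists c : A, c != 1.
  apply: contrapT => nc; suff : (1 : int)%R = 0%R by [].
  apply: th_faithful => c; have [->|c1] := eqVneq c 1; first exact: int_act1.
  by case: nc; exists c.
have tg1 : tg_twist th <> 1.
  move=> t1; suff : (1 : int)%R = 0%R by [].
  apply: th_faithful => d; apply: (@rm_inj _ false word0).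
  have := (cocycle_twist th).1 false d word0.
  by rewrite -[twist th]/(val (tg_twist th)) t1.
pose b : G := tg_lmul th true c * tg_twist th * tg_lmul th true c^-1.
have bE w : val b w = lmul th true c (twist th (lmul th true c^-1 w)) by [].
apply: (@not_Cstar_simple_of_disjoint_supports R G [set g : G | val g word0 = word0] _
    (tg_twist th) b) => //.
- split=> [//|g h /= go ho|g /= go].
    by rewrite -[LHS]/(val g (val h word0)) ho.
  by rewrite -{1}go; exact: bij_funK.
- exact: folner_stabilizer.
- move=> b1; apply: tg1; apply: val_inj; apply: bijP => w.
  have := bE (lmul th true c w); rewrite b1.
  rewrite -[lmul th true c^-1 (lmul th true c w)]/(bij_inv (lmul th true c) (lmul th true c w)).
  by rewrite bij_funK => /(can_inj (@bij_funK _ (lmul th true c))).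
move=> v; set w := val v word0.
have fixJ (g h : G) : val g (val h word0) = val h word0 -> val (g ^ h) word0 = word0.
  move=> gh; rewrite -[LHS]/(bij_inv (val h) (val g (val h word0))) gh.
  exact: bij_funK.
have [sw|sw] := boolP (starts false w).
  by left; apply: fixJ; rewrite bE lmul_twist_fix.
right; split; first by apply: fixJ; exact: twist_fix.
(* If [b w] started in the factor [false], then [b] would fix it, so [b w = w] by injectivity,
   against the choice of [w]. *)
apply: fixJ; apply: twist_fix; rewrite -[X in starts _ X]/(wseq (val b w)).
apply: contra sw => sbw.
have : val b (val b w) = val b w by rewrite [LHS]bE lmul_twist_fix.
by move=> /(can_inj (@bij_funK _ (val b))) bw; rewrite -bw.
Qed.

Lemma countable_twist_group : countable [set: A] -> countable [set: G].
Proof.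
move=> cA; apply: countable_subgrp.
have -> : twist_generators th = \bigcup_(t in [set: bool])
    if t then [set twist th] else [set lmul th p.1 p.2 | p in [set: bool * A]].
  apply/seteqP; split=> [p [->|[i [c ->]]]|p [[] _]].
  - by exists true.
  - by exists false => //; exists (i, c).
  - by left.
  - by move=> [[i c] _ <-]; right; exists i, c.
apply: bigcup_countable => [|[] _]; [exact: countableP|exact: countable1|].
apply: sub_countable (card_image_le _ _) _.
by rewrite -setXTT; apply: countableX.
Qed.

(** In each factor, the letters whose translation is generated form a subgroup containing [S]. *)
Lemma finitely_generated_twist_group : finitely_generated A -> finitely_generated G.
Proof.
move=> [S finS genS].
pose S' : set G := [set tg_twist th] `|` [set tg_lmul th p.1 p.2 | p in [set: bool] `*` S].
exists S'; first by rewrite finite_setU; split=> //; apply: finite_image; exact: finite_setX.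
have Ksub := is_subgroup_generated S'; set K := smallest _ _ in Ksub *.
have [K1 KM KV] := Ksub.
have KS' : S' `<=` K by exact: sub_gen_smallest.
have Kl i c : K (tg_lmul th i c).
  have lM d e : tg_lmul th i (d * e) = tg_lmul th i d * tg_lmul th i e.
    by apply: val_inj; exact: lmulM.
  have l1 : tg_lmul th i 1 = 1.
    by apply: (mulgI (tg_lmul th i 1)); rewrite -lM !mulg1.
  have lV d : tg_lmul th i d^-1 = (tg_lmul th i d)^-1.
    by apply/eqP; rewrite -mulg_eq1 -lM mulVg l1.
  have genc : smallest (@is_subgroup A) S c by rewrite genS.
  refine (@smallest_sub _ (@is_subgroup A) S [set d | K (tg_lmul th i d)] _ _ c genc).
    split=> [|d e|d] /=; rewrite ?l1 ?lM ?lV //; [exact: KM|exact: KV].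
  by move=> d Sd; apply: KS'; right; exists (i, d).
apply: subgrp_ind => // p Sp; case=> [ep|[i [c ep]]].
  by rewrite (_ : Subgrp Sp = tg_twist th); [apply: KS'; left|apply: val_inj].
by rewrite (_ : Subgrp Sp = tg_lmul th i c); [exact: Kl|apply: val_inj].
Qed.

End TwistGroupProperties.

(** * The shear action on the product with Z^2 *)

Section Shear.
Definition int2 := (int * int)%type.
HB.instance Definition _ := Choice.on int2.

Definition int2M (x y : int2) : int2 := (x.1 + y.1, x.2 + y.2)%R.
Definition int21 : int2 := (0, 0)%R.
Definition int2V (x : int2) : int2 := (- x.1, - x.2)%R.
Fact int2MA : associative int2M.
Proof. by move=> x y z; rewrite /int2M /= !GRing.addrA. Qed.
Fact int21M : left_id int21 int2M.
Proof. by case=> x y; rewrite /int2M /= !GRing.add0r. Qed.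
Fact int2M1 : right_id int21 int2M.
Proof. by case=> x y; rewrite /int2M /= !GRing.addr0. Qed.
Fact int2VM : left_inverse int21 int2V int2M.
Proof. by case=> x y; rewrite /int2M /= !GRing.addNr. Qed.
Fact int2MV : right_inverse int21 int2V int2M.
Proof. by case=> x y; rewrite /int2M /= !GRing.addrN. Qed.
HB.instance Definition _ := isGroup.Build int2 int2MA int21M int2M1 int2VM int2MV.

Lemma int2X (x : int2) n : x ^+ n = (x.1 *+ n, x.2 *+ n)%R.
Proof.
elim: n => [|n IH]; first by [].
by rewrite expgS IH !GRing.mulrS.
Qed.

Variable Gamma : groupType.
Local Notation A := (Gamma * int2)%type.

Definition shear (n : int) (c : A) : A := (c.1, (c.2.1 + n * c.2.2, c.2.2)%R).

Fact shear0 c : shear 0 c = c.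
Proof. by case: c => g [x y]; rewrite /shear /= GRing.mul0r GRing.addr0. Qed.
Fact shearD m n c : shear (m + n) c = shear m (shear n c).
Proof. by rewrite /shear /=; congr (_, (_, _)); ring. Qed.
Fact shearM n (c d : A) : shear n (c * d) = shear n c * shear n d.
Proof.
case: c d => g [x y] [h [x' y']]; congr (_, (_, _)).
by rewrite /=; ring.
Qed.

Definition shear_action := IntAction shear0 shearD shearM.

(** The shift by one keeps all of these nontrivial and moved by every nonzero power of the shear. *)
Definition vertical (n : nat) : A := (1, (0%R, Posz n.+1)).

Lemma shear_faithful n : (forall c, shear_action n c = c) -> n = 0%R.
Proof. by move=> /(_ (1, (0, 1)%R)) [] /=; lia. Qed.

Lemma vertical_inj : injective vertical.
Proof. by move=> m n []. Qed.

Lemma vertical_neq1 n : vertical n != 1.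
Proof. by apply/eqP => -[]. Qed.

(** With [e = (g, (x, y))] the two equations give [g = 1], [y = 0], [x + k (m + 1) = 0] and
    [x + k (n + 1) = 0]; subtracting the last two yields [k = 0], then [x = 0]. *)
Lemma vertical_moved (e : A) k m n : m <> n ->
  e * shear_action k (vertical m) = vertical m ->
  e * shear_action k (vertical n) = vertical n -> e = 1.
Proof.
case: e => g [x y] mn [/=]; rewrite mulg1 => -> em em' [_ en _].
have y0 : y = 0%R by lia.
have k0 : k = 0%R by nia.
by rewrite (_ : x = 0%R) ?y0 //; rewrite k0 in en; lia.
Qed.

Lemma torsion_free_shear : torsion_free Gamma -> torsion_free A.
Proof.
move=> tf [g v] n n0 gvn.
have X1 m : (g, v) ^+ m = (g ^+ m, v ^+ m).
  by elim: m => // m IH; rewrite !expgS IH.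
move: gvn; rewrite X1 int2X; case: v {X1} => x y [/(tf _ _ n0) -> /eqP xn /eqP yn].
move: xn yn; rewrite !mulrn_eq0 eqn0Ngt n0 /= => /eqP -> /eqP ->.
by [].
Qed.

Lemma finitely_generated_shear : finitely_generated Gamma -> finitely_generated A.
Proof.
move=> [S finS genS].
pose e1 : A := (1, (1%R, 0%R)); pose e2 : A := (1, (0%R, 1%R)).
pose S' : set A := [set (s, 1) | s in S] `|` [set e1; e2].
exists S'.
  by rewrite !finite_setU; split; [exact: finite_image|split; exact: finite_set1].
have Ksub : is_subgroup (smallest (@is_subgroup A) S') := is_subgroup_generated S'.
set K := smallest _ _ in Ksub *; have [K1 KM KV] := Ksub.
have KS' : S' `<=` K by exact: sub_gen_smallest.
have Kg g : K (g, 1).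
  have geng : smallest (@is_subgroup Gamma) S g by rewrite genS.
  refine (@smallest_sub _ (@is_subgroup Gamma) S [set h | K (h, 1)] _ _ g geng).
    split=> [|h h' Kh Kh'|h Kh]; [exact: K1| |].
      by have := KM _ _ Kh Kh'.
    by have := KV _ Kh.
  by move=> h Sh; apply: KS'; left; exists h.
have Kz (u : A) : K u -> forall z : int, u.1 = 1 -> K (1, (u.2.1 * z, u.2.2 * z)%R : int2).
  case: u => h [x y] Ku z /= h1; rewrite h1 in Ku.
  have Kn (n : nat) : K (1, (x * Posz n, y * Posz n)%R : int2).
    elim: n => [|n IH]; first by rewrite !GRing.mulr0; exact: K1.
    have := KM _ _ Ku IH; congr K; congr (_, (_, _)); first exact: mulg1.
      by rewrite /=; lia.
    by rewrite /=; lia.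
  case: z => n; first exact: Kn.
  have := KV _ (Kn n.+1); congr K; congr (_, (_, _)); first exact: invg1.
    by rewrite /=; lia.
  by rewrite /=; lia.
apply/seteqP; split=> // -[g [x y]] _.
have Kx := Kz _ (KS' _ (or_intror (or_introl erefl))) x erefl.
have Ky := Kz _ (KS' _ (or_intror (or_intror erefl))) y erefl.
have := KM _ _ (Kg g) (KM _ _ Kx Ky); congr K; congr (_, (_, _)) => /=.
- by rewrite !mulg1.
- by rewrite /=; lia.
- by rewrite /=; lia.
Qed.

End Shear.

Theorem theoremD (R : realType) (Gamma : groupType)
    (Gamma_countable : countable [set: Gamma]) :
  exists G : groupType,
    countable [set: G] /\
    embeds Gamma G /\
    trivial_amenable_radical R G /\
    ~ Cstar_simple R G /\
    (finitely_generated Gamma -> finitely_generated G) /\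
    (torsion_free Gamma -> torsion_free G).
Proof.
pose th := shear_action Gamma; have faithful := @shear_faithful Gamma.
exists (twist_group th); split; last split; last split; last split; last split.
- apply: countable_twist_group.
  rewrite -[[set: (Gamma * int2)%type]]setXTT; apply: countableX => //.
  by rewrite -[[set: int2]]/[set: int * int]; exact: countableP.
- pose f (g : Gamma) : twist_group th := tg_lmul th false (g, 1).
  have fM : {morph f : g h / g * h}.
    by move=> g h; apply: val_inj; rewrite /= -lmulM.
  pose F := HB.pack_for {multiplicative Gamma -> twist_group th} f
    (isMultiplicative.Build _ _ f fM).
  (* Translations by letters are separated by their values at the empty word. *)
  exists F => g h /(congr1 (fun p : twist_group th => val p word0)).
  by move=> /rm_inj [].
- exact: (trivial_amenable_radical_twist_group (@vertical_inj Gamma)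
    (@vertical_neq1 Gamma) (@vertical_moved Gamma)).
- exact: not_Cstar_simple_twist_group.
- by move=> /finitely_generated_shear; exact: finitely_generated_twist_group.
- move=> /torsion_free_shear tf; exact: torsion_free_twist_group.
Qed.
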